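(* Let $V$ be the first fundamental $U_{r,s}(\mathfrak{sp}_{2n})$-module with basis $v_1,\dots,v_{2n}$ described in the context. The $U_{r,s}(\mathfrak{sp}_{2n})$-module isomorphism $\hat R_{VV}=\Theta\circ\widetilde f\circ\tau\colon V\otimes V\to V\otimes V$ coincides with the operator $$\begin{aligned}\hat R={}& r^{-1/2}s^{1/2}\sum_{i=1}^{2n}E_{ii}\otimes E_{ii}+r^{1/2}s^{-1/2}\sum_{i=1}^{2n}E_{ii'}\otimes E_{i'i}+\sum_{1\le i,j\le 2n,\ j\ne i,i'}a_{ij}E_{ij}\otimes E_{ji}\\&+(s-r)(rs)^{-1/2}\sum_{i=1}^n\bigl(r^{n+1-i}s^{i-n-1}+1\bigr)E_{i'i'}\otimes E_{ii}\\&+(s-r)(rs)^{-1/2}\sum_{i>j,\ j\ne i'}E_{ii}\otimes E_{jj}+(r-s)(rs)^{-1/2}\sum_{i<j,\ j\neq i'}t_it_j^{-1}E_{i'j}\otimes E_{ij'},\end{aligned}$$ where $t_i=s^{i-n-1}$ if $i\le n$ and $t_i=-r^{n-i}$ if $i>n$; $\sigma_i=1$ if $i\le n$ and $\sigma_i=-1$ if $i>n$; and $a_{ij}=(rs)^{-\frac12\sigma_i\sigma_j}$ if ($i<j$ and $i<j'$) or ($i>j$ and $i>j'$), while $a_{ij}=(rs)^{\frac12\sigma_i\sigma_j}$ if $j<i<j'$ or $j'<i<j$.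
   Context: $\mathbb K$ is an algebraically closed field containing $\mathbb C(r,s)$ with $r,s$ indeterminates; square roots $r^{1/2},s^{1/2}\in\mathbb K$ are fixed and $(rs)^{1/2}=r^{1/2}s^{1/2}$. **Root data (type $C_n$).** $\varepsilon_1,\dots,\varepsilon_n$ is an orthonormal basis of $\mathbb R^n$; $\alpha_i=\varepsilon_i-\varepsilon_{i+1}$ ($i<n$), $\alpha_n=2\varepsilon_n$; $Q=\bigoplus\mathbb Z\alpha_i$. $c_{ij}=2(\alpha_i,\alpha_j)/(\alpha_i,\alpha_i)$, $d_i=(\alpha_i,\alpha_i)/2$, $r_i=r^{d_i}$, $s_i=s^{d_i}$. $\langle\cdot,\cdot\rangle$ is the ($\frac12\mathbb Z$-valued) bilinear form on $\bigoplus\mathbb Z\varepsilon_i$ with $\langle\varepsilon_i,\varepsilon_i\rangle=\frac12$, $\langle\varepsilon_i,\varepsilon_j\rangle=-\frac12$ for $i<j$ and $=\frac12$ for $i>j$; equivalently it is the bilinear extension of the form with $\langle\alpha_i,\alpha_j\rangle=d_ic_{ij}$ if $i<j$, $d_i$ if $i=j$, $0$ if $i>j$. **Algebra.** $[m]_{r,s}=\frac{r^m-s^m}{r-s}$, $[m]_{r,s}!=[m]_{r,s}\cdots[1]_{r,s}$, $\genfrac{[}{]}{0pt}{}{m}{k}_{r,s}=\frac{[m]_{r,s}!}{[m-k]_{r,s}![k]_{r,s}!}$. $U_{r,s}=U_{r,s}(\mathfrak{sp}_{2n})$ is the associative $\mathbb K$-algebra generated by $e_i,f_i,\omega_i^{\pm1},(\omega_i')^{\pm1}$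 ($1\le i\le n$) with relations: all $\omega_i^{\pm1},(\omega'_j)^{\pm1}$ commute and $\omega_i\omega_i^{-1}=1=\omega_i'(\omega_i')^{-1}$; $\omega_ie_j=r^{\langle\alpha_j,\alpha_i\rangle}s^{-\langle\alpha_i,\alpha_j\rangle}e_j\omega_i$, $\omega_if_j=r^{-\langle\alpha_j,\alpha_i\rangle}s^{\langle\alpha_i,\alpha_j\rangle}f_j\omega_i$, $\omega_i'e_j=r^{-\langle\alpha_i,\alpha_j\rangle}s^{\langle\alpha_j,\alpha_i\rangle}e_j\omega_i'$, $\omega_i'f_j=r^{\langle\alpha_i,\alpha_j\rangle}s^{-\langle\alpha_j,\alpha_i\rangle}f_j\omega_i'$; $e_if_j-f_je_i=\delta_{ij}\frac{\omega_i-\omega_i'}{r_i-s_i}$; and for $i\ne j$, $\sum_{k=0}^{1-c_{ij}}(-1)^k\genfrac{[}{]}{0pt}{}{1-c_{ij}}{k}_{r_i,s_i}(r_is_i)^{k(k-1)/2}(rs)^{k\langle\alpha_j,\alpha_i\rangle}e_i^{1-c_{ij}-k}e_je_i^k=0$ and the same with $e_i^{1-c_{ij}-k}e_je_i^k$ replaced by $f_i^kf_jf_i^{1-c_{ij}-k}$. Coproduct: $\omega_i,\omega_i'$ are group-like, $\Delta(e_i)=e_i\otimes1+\omega_i\otimes e_i$, $\Delta(f_i)=1\otimes f_i+f_i\otimes\omega_i'$. For $\mu=\sum k_i\alpha_i\in Q$: $\omega_\mu=\prod\omega_i^{k_i}$, $\omega'_\mu=\prod(\omega'_i)^{k_i}$.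 $U^+$, $U^-$ are the subalgebras generated by the $e_i$, resp. the $f_i$; $U^{\ge}$ by the $e_i,\omega_i^{\pm1}$; $U^{\le}$ by the $f_i,(\omega_i')^{\pm1}$; they are $Q$-graded with $\deg e_i=\alpha_i=-\deg f_i$, $\deg \omega_i=\deg\omega_i'=0$. **Pairing, $\Theta$, $\widetilde f$.** $(\cdot,\cdot)\colon U^{\le}\times U^{\ge}\to\mathbb K$ is the unique bilinear pairing with $(yy',x)=(y\otimes y',\Delta(x))$, $(y,xx')=(\Delta(y),x'\otimes x)$, $(f_i,\omega_j)=0=(\omega_i',e_j)$, $(f_i,e_j)=\delta_{ij}/(s_i-r_i)$, $(\omega'_\lambda,\omega_\mu)=r^{\langle\lambda,\mu\rangle}s^{-\langle\mu,\lambda\rangle}$ for $\lambda,\mu\in Q$; the last formula is also used as notation for $\lambda,\mu\in\bigoplus\mathbb Z\varepsilon_i$. For $\mu>0$ in $Q$ let $\{x_i^\mu\}$, $\{y_i^\mu\}$ be dual bases of $U^+_\mu$, $U^-_{-\mu}$, $\Theta_\mu=\sum_iy_i^\mu\otimes x_i^\mu$, $\Theta=1+\sum_{\mu>0}\Theta_\mu$ (acting on a tensor product of finite-dimensional modules by a finite sum). A vector $v$ has weight $\lambda$ if $\omega_iv=(\omega'_\lambda,\omega_i)v$ and $\omega'_iv=(\omega'_i,\omega_\lambda)^{-1}v$ for all $i$ (with $\omega_i=\omega_{\alpha_i}$, $\omega'_i=\omega'_{\alpha_i}$). $\widetilde f(v\otimes w)=f(\lambda,\mu)\,v\otimes w$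 for $v,w$ of weights $\lambda,\mu$, where $f(\lambda,\mu)=(\omega'_\mu,\omega_\lambda)^{-1}=r^{-\langle\mu,\lambda\rangle}s^{\langle\lambda,\mu\rangle}$. $\tau(v\otimes w)=w\otimes v$. **Module.** $N=2n$, $i'=N+1-i$, $V=\mathbb K^{N}$ with basis $v_1,\dots,v_N$ and matrix units $E_{ij}v_k=\delta_{jk}v_i$. $v_k$ has weight $\varepsilon_k$, where $\varepsilon_{k'}=-\varepsilon_k$ for $k\le n$ (this determines the action of $\omega_i,\omega_i'$); $e_i=E_{i,i+1}-E_{(i+1)',i'}$ and $f_i=E_{i+1,i}-(rs)^{-1}E_{i',(i+1)'}$ for $i<n$; $e_n=E_{nn'}$, $f_n=(rs)^{-1}E_{n'n}$. In all sums indices run over $1,\dots,2n$ unless otherwise indicated. *)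

(* Defs.v *)
From HB Require Import structures.
From mathcomp Require Import all_boot all_order all_algebra finmap.
From mathcomp Require Import generic_quotient ring_quotient fraction.
From mathcomp Require Import complex mxtens.
From mathcomp Require Import boolp classical_sets fsbigop reals.
From mathcomp Require Import monalg.
Set Implicit Arguments.
Unset Strict Implicit.
Unset Printing Implicit Defensive.
Import GRing.Theory.
Local Open Scope ring_scope.
Local Open Scope quotient_scope.

(* The free algebra: [{malg K[{fmonom G}]}] with a sealed multiplication, so
   that a failed conversion between two products stays cheap. *)
Section FreeAlgebra.
Variables (K : fieldType) (G : choiceType).
Local Notation malgebra := {malg K[{fmonom G}]}.

Definition free_alg : Type := malgebra.
HB.instance Definition _ := GRing.Lmodule.on free_alg.

Definition free_mul : free_alg -> free_alg -> free_alg :=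
  locked (fun x y : malgebra => x * y).
Definition free_one : free_alg := (1 : malgebra).

Fact free_mulE : free_mul = (fun x y : malgebra => x * y).
Proof. by rewrite /free_mul -lock. Qed.

Fact free_mulA : associative free_mul.
Proof. by rewrite free_mulE; exact: mulrA. Qed.
Fact free_mul1r : left_id free_one free_mul.
Proof. by rewrite free_mulE; exact: mul1r. Qed.
Fact free_mulr1 : right_id free_one free_mul.
Proof. by rewrite free_mulE; exact: mulr1. Qed.
Fact free_mulDl : left_distributive free_mul +%R.
Proof. by rewrite free_mulE; exact: mulrDl. Qed.
Fact free_mulDr : right_distributive free_mul +%R.
Proof. by rewrite free_mulE; exact: mulrDr. Qed.
Fact free_oner_neq0 : free_one != 0.
Proof. exact: (@oner_neq0 malgebra). Qed.
HB.instance Definition _ := GRing.Zmodule_isNzRing.Build free_alg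
  free_mulA free_mul1r free_mulr1 free_mulDl free_mulDr free_oner_neq0.

Fact free_scaleAl (c : K) (x y : free_alg) :
  c *: (x * y) = (c *: x : free_alg) * y.
Proof.
change (c *: free_mul x y = free_mul (c *: x) y).
by rewrite free_mulE; exact: scalerAl.
Qed.
HB.instance Definition _ :=
  GRing.Lmodule_isLalgebra.Build K free_alg free_scaleAl.

Fact malg_scaleU (c a : K) (m : {fmonom G}) :
  c *: << a *g m >> = << c * a *g m >> :> malgebra.
Proof.
by apply/malgP => k; rewrite mcoeffZ [in LHS]mcoeffU [in RHS]mcoeffU mulrnAr.
Qed.

Fact free_scaleAr (c : K) (x y : free_alg) : c *: (x * y) = x * (c *: y).
Proof.
change (c *: free_mul x y = free_mul x (c *: y)); rewrite free_mulE.
rewrite [RHS](malgMEw (fsubset_refl _) (msuppZ_le c y)) malgME scaler_sumr.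
apply: eq_bigr => k _; rewrite scaler_sumr; apply: eq_bigr => l _.
by rewrite malg_scaleU mcoeffZ mulrCA.
Qed.
HB.instance Definition _ :=
  GRing.LSemiAlgebra_isSemiAlgebra.Build K free_alg free_scaleAr.

Definition fgen (g : G) : free_alg := locked (<< fmu g >> : malgebra).

(* The character sending the generator g to [chi g]. *)
Definition word_eval (chi : G -> K) (m : {fmonom G}) : K :=
  \prod_(g <- (m : seq G)) chi g.

Fact word_eval_mmorphism chi : mmorphism (word_eval chi).
Proof.
by split=> [m1 m2|]; rewrite /word_eval ?fmM ?big_cat // fm1 big_nil.
Qed.
HB.instance Definition _ chi :=
  monalg.isMultiplicative.Build {fmonom G} K (word_eval chi)
    (word_eval_mmorphism chi).

Definition free_eval (chi : G -> K) : free_alg -> K :=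
  locked (mmap idfun (word_eval chi) : malgebra -> K).

Lemma free_eval_gen chi g : free_eval chi (fgen g) = chi g.
Proof.
by rewrite /free_eval /fgen -!lock mmapU mul1r /word_eval fmU big_seq1. Qed.
Lemma free_evalD chi x y :
  free_eval chi (x + y) = free_eval chi x + free_eval chi y.
Proof. by rewrite /free_eval -lock; exact: rmorphD. Qed.
Lemma free_evalB chi x y :
  free_eval chi (x - y) = free_eval chi x - free_eval chi y.
Proof. by rewrite /free_eval -lock; exact: rmorphB. Qed.
Lemma free_evalM chi x y :
  free_eval chi (x * y) = free_eval chi x * free_eval chi y.
Proof.
change (free_eval chi (free_mul x y) = free_eval chi x * free_eval chi y).
by rewrite free_mulE /free_eval -lock; exact: rmorphM.
Qed.
Lemma free_evalZ chi c x : free_eval chi (c *: x) = c * free_eval chi x.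
Proof. by rewrite /free_eval -lock; exact: linearZ. Qed.
Lemma free_eval0 chi : free_eval chi 0 = 0.
Proof. by rewrite /free_eval -lock; exact: rmorph0. Qed.
Lemma free_eval1 chi : free_eval chi 1 = 1.
Proof. by rewrite /free_eval -lock; exact: rmorph1. Qed.
Lemma free_eval_sum chi (I : Type) (l : seq I) (F : I -> free_alg) :
  free_eval chi (\sum_(i <- l) F i) = \sum_(i <- l) free_eval chi (F i).
Proof.
by elim/big_rec2: _ => [|i a b _ <-]; rewrite ?free_eval0 ?free_evalD.
Qed.
End FreeAlgebra.

(* The K-algebra with generators [G] and defining relations [x = 0], [rel x]. *)
Section PresentedAlgebra.
Variables (K : fieldType) (G : choiceType).
Local Notation freealg := (free_alg K G).

Variable rel : freealg -> Prop.

Inductive relation_ideal : freealg -> Prop :=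
| relation_ideal0 : relation_ideal 0
| relation_idealD x y :
    relation_ideal x -> relation_ideal y -> relation_ideal (x + y)
| relation_idealM a x b : rel x -> relation_ideal (a * x * b).

Definition relation_pred : pred freealg := fun x => `[< relation_ideal x >].

Lemma relation_ideal_mull a x : relation_ideal x -> relation_ideal (a * x).
Proof.
elim=> [|y z _ Hy _ Hz|b y c Ry]; first by rewrite mulr0; apply: relation_ideal0.
- by rewrite mulrDr; apply: relation_idealD.
- by rewrite !mulrA; apply: relation_idealM.
Qed.

Lemma relation_ideal_mulr x b : relation_ideal x -> relation_ideal (x * b).
Proof.
elim=> [|y z _ Hy _ Hz|a y c Ry]; first by rewrite mul0r; apply: relation_ideal0.
- by rewrite mulrDl; apply: relation_idealD.
- by rewrite -mulrA; apply: relation_idealM.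
Qed.

Fact relation_pred_zmod_closed : zmod_closed relation_pred.
Proof.
split=> [|x y /asboolP Ix /asboolP Iy]; apply/asboolP; first exact: relation_ideal0.
by apply: relation_idealD => //; rewrite -mulN1r; apply: relation_ideal_mull.
Qed.
HB.instance Definition _ :=
  GRing.isZmodClosed.Build freealg relation_pred relation_pred_zmod_closed.

Definition relation_zmod : zmodClosed freealg :=
  GRing.ZmodClosed.clone freealg relation_pred _.
Definition presented := Quotient.quot relation_zmod.
HB.instance Definition _ := GRing.Zmodule.on presented.

Definition presented_pi : freealg -> presented := \pi_(presented).
Definition presented_repr : presented -> freealg := @repr freealg presented.

Lemma presented_reprK : cancel presented_repr presented_pi.
Proof. exact: reprK. Qed.

Lemma presented_ind (P : presented -> Prop) :
  (forall x, P (presented_pi x)) -> forall u, P u.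
Proof. by move=> H u; rewrite -[u]presented_reprK. Qed.

Lemma presented_eqP (x y : freealg) :
  presented_pi x = presented_pi y <-> relation_ideal (x - y).
Proof.
rewrite /presented_pi; split=> [/eqP|H].
  by rewrite -Quotient.idealrBE => /asboolP.
by apply/eqP; rewrite -Quotient.idealrBE; apply/asboolP.
Qed.

Lemma presented_reprP x : relation_ideal (x - presented_repr (presented_pi x)).
Proof. by apply/presented_eqP; rewrite presented_reprK. Qed.

Definition presented_one : presented := presented_pi 1.
Definition presented_mul : presented -> presented -> presented :=
  locked (fun u v => presented_pi (presented_repr u * presented_repr v)).
Definition presented_scale : K -> presented -> presented :=
  locked (fun c u => presented_pi (c *: presented_repr u)).

Lemma presented_piD : {morph presented_pi : x y / x + y}.
Proof. by move=> x y; rewrite /presented_pi !piE. Qed.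

Fact presented_mulE x y :
  presented_mul (presented_pi x) (presented_pi y) = presented_pi (x * y).
Proof.
rewrite /presented_mul -lock.
apply/esym/presented_eqP; set x' := presented_repr _; set y' := presented_repr _.
have -> : x * y - x' * y' = (x - x') * y + x' * (y - y').
  by rewrite mulrBl mulrBr addrA subrK.
apply: relation_idealD; first exact/relation_ideal_mulr/presented_reprP.
exact/relation_ideal_mull/presented_reprP.
Qed.

Fact presented_scaleE c x :
  presented_scale c (presented_pi x) = presented_pi (c *: x).
Proof.
rewrite /presented_scale -lock.
apply/esym/presented_eqP; rewrite -scalerBr -[x - _]mul1r scalerAl.
exact/relation_ideal_mull/presented_reprP.
Qed.

Fact presented_mulA : associative presented_mul.
Proof.
elim/presented_ind=> x; elim/presented_ind=> y; elim/presented_ind=> z.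
by rewrite !presented_mulE mulrA.
Qed.
Fact presented_mul1r : left_id presented_one presented_mul.
Proof. by elim/presented_ind=> x; rewrite presented_mulE mul1r. Qed.
Fact presented_mulr1 : right_id presented_one presented_mul.
Proof. by elim/presented_ind=> x; rewrite presented_mulE mulr1. Qed.
Fact presented_mulDl : left_distributive presented_mul +%R.
Proof.
elim/presented_ind=> x; elim/presented_ind=> y; elim/presented_ind=> z.
by rewrite -presented_piD !presented_mulE mulrDl presented_piD.
Qed.
Fact presented_mulDr : right_distributive presented_mul +%R.
Proof.
elim/presented_ind=> x; elim/presented_ind=> y; elim/presented_ind=> z.
by rewrite -presented_piD !presented_mulE mulrDr presented_piD.
Qed.
HB.instance Definition _ := GRing.Zmodule_isPzRing.Build presented
  presented_mulA presented_mul1r presented_mulr1 presented_mulDl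
  presented_mulDr.

Fact presented_scaleA c d u :
  presented_scale c (presented_scale d u) = presented_scale (c * d) u.
Proof. by elim/presented_ind: u => x; rewrite !presented_scaleE scalerA. Qed.
Fact presented_scale1 : left_id 1 presented_scale.
Proof. by elim/presented_ind=> x; rewrite presented_scaleE scale1r. Qed.
Fact presented_scaleDr : right_distributive presented_scale +%R.
Proof.
move=> c; elim/presented_ind=> x; elim/presented_ind=> y.
by rewrite -presented_piD !presented_scaleE scalerDr presented_piD.
Qed.
Fact presented_scaleDl u : {morph presented_scale^~ u : c d / c + d}.
Proof.
move=> c d; elim/presented_ind: u => x.
by rewrite !presented_scaleE scalerDl presented_piD.
Qed.
HB.instance Definition _ := GRing.Zmodule_isLmodule.Build K presented
  presented_scaleA presented_scale1 presented_scaleDr presented_scaleDl.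

Lemma presented_scaleAl (c : K) (u v : presented) :
  c *: (u * v) = (c *: u) * v.
Proof.
elim/presented_ind: u => x; elim/presented_ind: v => y.
by rewrite /GRing.scale /GRing.mul /= !(presented_mulE, presented_scaleE)
  scalerAl.
Qed.

Lemma presented_scaleAr (c : K) (u v : presented) :
  c *: (u * v) = u * (c *: v).
Proof.
elim/presented_ind: u => x; elim/presented_ind: v => y.
by rewrite /GRing.scale /GRing.mul /= !(presented_mulE, presented_scaleE)
  scalerAr.
Qed.

Fact presented_pi_zmod_morphism : zmod_morphism presented_pi.
Proof. by move=> x y; rewrite /presented_pi !piE. Qed.
HB.instance Definition _ :=
  GRing.isZmodMorphism.Build freealg presented presented_pi
    presented_pi_zmod_morphism.

Fact presented_pi_monoid_morphism : monoid_morphism presented_pi.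
Proof. by split=> [|x y]; [| exact/esym/presented_mulE]. Qed.
HB.instance Definition _ :=
  GRing.isMonoidMorphism.Build freealg presented presented_pi
    presented_pi_monoid_morphism.

Fact presented_pi_scalable : scalable presented_pi.
Proof. by move=> c x; rewrite -presented_scaleE. Qed.
HB.instance Definition _ :=
  GRing.isScalable.Build K freealg presented *:%R presented_pi
    presented_pi_scalable.

Lemma presented_oner_neq0 chi :
  (forall x, rel x -> free_eval chi x = 0) -> (1 : presented) != 0.
Proof.
move=> chi0; apply/eqP => eq10.
have /presented_eqP : presented_pi 1 = presented_pi 0.
  by rewrite rmorph1 rmorph0.
rewrite subr0; suff eval0 x : relation_ideal x -> free_eval chi x = 0.
  by move/eval0/eqP; rewrite free_eval1 oner_eq0.
elim=> [|y z _ Hy _ Hz|a y b Ry]; first exact: free_eval0.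
- by rewrite free_evalD Hy Hz addr0.
- by rewrite !free_evalM (chi0 _ Ry) mulr0 mul0r.
Qed.
End PresentedAlgebra.

(* A (x) B as the algebra generated by the symbols a (x) b subject to
   bilinearity and (a (x) b)(a' (x) b') = aa' (x) bb'. *)
Section TensorAlgebra.
Variables (K : fieldType) (A B : algType K).
Local Notation freealg := (free_alg K (A * B)%type).
Local Notation sym a b := (fgen K (a, b)).

Inductive tensor_rel : freealg -> Prop :=
| tensor_rel_addl a a' b :
    tensor_rel (sym (a + a') b - sym a b - sym a' b)
| tensor_rel_addr a b b' :
    tensor_rel (sym a (b + b') - sym a b - sym a b')
| tensor_rel_scalel c a b : tensor_rel (sym (c *: a) b - c *: sym a b)
| tensor_rel_scaler c a b : tensor_rel (sym a (c *: b) - c *: sym a b)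
| tensor_rel_mul a a' b b' :
    tensor_rel (sym a b * sym a' b' - sym (a * a') (b * b'))
| tensor_rel_one : tensor_rel (sym 1 1 - 1).

Definition tensor_alg := presented tensor_rel.
HB.instance Definition _ := GRing.PzRing.on tensor_alg.
HB.instance Definition _ := GRing.Lmodule.on tensor_alg.

Definition tens (a : A) (b : B) : tensor_alg :=
  presented_pi tensor_rel (sym a b).

Definition tens_sum (ts : seq (A * B)) : tensor_alg :=
  \sum_(p <- ts) tens p.1 p.2.
End TensorAlgebra.

Section Subspaces.
Variables (K : fieldType) (A : algType K).

Inductive generated_subalg (S : A -> Prop) : A -> Prop :=
| generated_subalg_gen a : S a -> generated_subalg S a
| generated_subalg_one : generated_subalg S 1
| generated_subalg_linear c a b : generated_subalg S a ->
    generated_subalg S b -> generated_subalg S (c *: a + b)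
| generated_subalg_mul a b : generated_subalg S a ->
    generated_subalg S b -> generated_subalg S (a * b).

Inductive linear_span (S : A -> Prop) : A -> Prop :=
| linear_span0 : linear_span S 0
| linear_spanP c a b :
    S a -> linear_span S b -> linear_span S (c *: a + b).

Definition is_basis (W : A -> Prop) (d : nat) (b : 'I_d -> A) : Prop :=
  [/\ forall i, W (b i),
      forall c : 'I_d -> K, \sum_i c i *: b i = 0 -> forall i, c i = 0
    & forall a, W a -> exists c : 'I_d -> K, a = \sum_i c i *: b i].
End Subspaces.

(* Vectors are written in the basis eps_1, ..., eps_n of Z^n; all indices are
   0-based, so [eps k] and [alpha i] are eps_(k+1) and alpha_(i+1). *)
Section RootData.
Variable n : nat.
Implicit Types (lambda mu : 'rV[int]_n) (i j : 'I_n).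

Definition eps (k : nat) : 'rV[int]_n := \row_j (j == k :> nat)%:R.

Definition alpha i : 'rV[int]_n :=
  if (i.+1 < n)%N then eps i - eps i.+1 else eps i *+ 2.

Definition dot lambda mu : int := \sum_i lambda 0 i * mu 0 i.
Definition cartan i j : int :=
  ((dot (alpha i) (alpha j) *+ 2) %/ dot (alpha i) (alpha i))%Z.
Definition half_len i : int := (dot (alpha i) (alpha i) %/ 2)%Z.

(* [form2 lambda mu] is 2 <lambda, mu>: the form is half-integral. *)
Definition form2 lambda mu : int :=
  \sum_(i < n) \sum_(j < n)
    (if (j <= i)%N then 1 else -1) * (lambda 0 i * mu 0 j).

Definition root_comb (k : 'I_n -> int) : 'rV[int]_n := \sum_i alpha i *~ k i.

Definition positive_weight mu : Prop :=
  mu != 0 /\ exists k : 'I_n -> nat, mu = root_comb (fun i => (k i)%:Z).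
End RootData.
Arguments eps {n} k.

Section QuantumNumbers.
Variables (K : fieldType) (a b : K).
Definition qnum (m : nat) : K := (a ^+ m - b ^+ m) / (a - b).
Definition qfact (m : nat) : K := \prod_(1 <= k < m.+1) qnum k.
Definition qbin (m k : nat) : K := qfact m / (qfact (m - k) * qfact k).
End QuantumNumbers.

Inductive ugen (n : nat) : Type :=
| Gen_e of 'I_n | Gen_f of 'I_n
| Gen_w of 'I_n | Gen_wV of 'I_n
| Gen_w' of 'I_n | Gen_w'V of 'I_n.
HB.instance Definition _ n := gen_eqMixin (ugen n).
HB.instance Definition _ n := gen_choiceMixin (ugen n).

Definition is_torus n (g : ugen n) : bool :=
  match g with Gen_e _ | Gen_f _ => false | _ => true end.

(* [rh] and [sh] are the fixed square roots of r and s. *)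
Section QuantumGroup.
Variables (K : fieldType) (rh sh : K) (n : nat).
Implicit Types (i j : 'I_n) (lambda mu : 'rV[int]_n).

Local Notation r := (rh ^+ 2).
Local Notation s := (sh ^+ 2).

Definition rform lambda mu : K := rh ^ form2 lambda mu.
Definition sform lambda mu : K := sh ^ form2 lambda mu.
Definition r_ i : K := r ^ half_len i.
Definition s_ i : K := s ^ half_len i.

(* the scalar (omega'_lambda, omega_mu) *)
Definition wpair lambda mu : K := rform lambda mu / sform mu lambda.

Definition serre_deg i j : nat := `|1 - cartan i j|%N.
Definition serre_coef i j (k : nat) : K :=
  (-1) ^+ k * qbin (r_ i) (s_ i) (serre_deg i j) k * (r_ i * s_ i) ^+ 'C(k, 2)
  * (rform (alpha j) (alpha i) * sform (alpha j) (alpha i)) ^+ k.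

Local Notation e i := (fgen K (Gen_e i)).
Local Notation f i := (fgen K (Gen_f i)).
Local Notation w i := (fgen K (Gen_w i)).
Local Notation wV i := (fgen K (Gen_wV i)).
Local Notation w' i := (fgen K (Gen_w' i)).
Local Notation w'V i := (fgen K (Gen_w'V i)).

Inductive U_rel : free_alg K (ugen n) -> Prop :=
| U_rel_torus a b : is_torus a -> is_torus b ->
    U_rel (fgen K a * fgen K b - fgen K b * fgen K a)
| U_rel_wV i : U_rel (w i * wV i - 1)
| U_rel_w'V i : U_rel (w' i * w'V i - 1)
| U_rel_we i j : U_rel (w i * e j -
    (rform (alpha j) (alpha i) * (sform (alpha i) (alpha j))^-1)
      *: (e j * w i))
| U_rel_wf i j : U_rel (w i * f j -
    ((rform (alpha j) (alpha i))^-1 * sform (alpha i) (alpha j))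
      *: (f j * w i))
| U_rel_w'e i j : U_rel (w' i * e j -
    ((rform (alpha i) (alpha j))^-1 * sform (alpha j) (alpha i))
      *: (e j * w' i))
| U_rel_w'f i j : U_rel (w' i * f j -
    (rform (alpha i) (alpha j) * (sform (alpha j) (alpha i))^-1)
      *: (f j * w' i))
| U_rel_ef i j : U_rel (e i * f j - f j * e i -
    ((i == j)%:R / (r_ i - s_ i)) *: (w i - w' i))
| U_rel_serre_e i j : i != j -> U_rel (\sum_(k < (serre_deg i j).+1)
    serre_coef i j k *: (e i ^+ (serre_deg i j - k) * e j * e i ^+ k))
| U_rel_serre_f i j : i != j -> U_rel (\sum_(k < (serre_deg i j).+1)
    serre_coef i j k *: (f i ^+ k * f j * f i ^+ (serre_deg i j - k))).

Definition Urs := presented U_rel.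
HB.instance Definition _ := GRing.PzRing.on Urs.
HB.instance Definition _ := GRing.Lmodule.on Urs.

Fact Urs_oner_neq0 : (1 : Urs) != 0.
Proof.
pose chi (g : ugen n) : K := (is_torus g)%:R.
have chiE := (free_evalB, free_evalM, free_evalZ, free_eval1, free_eval_gen).
apply: (@presented_oner_neq0 _ _ U_rel chi) => _ [].
- by move=> a b _ _; rewrite !chiE [X in _ - X]mulrC subrr.
- by move=> i; rewrite !chiE mulr1 subrr.
- by move=> i; rewrite !chiE mulr1 subrr.
- by move=> i j; rewrite !chiE /chi /= !(mulr0, mul0r) subrr.
- by move=> i j; rewrite !chiE /chi /= !(mulr0, mul0r) subrr.
- by move=> i j; rewrite !chiE /chi /= !(mulr0, mul0r) subrr.
- by move=> i j; rewrite !chiE /chi /= !(mulr0, mul0r) subrr.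
- by move=> i j; rewrite !chiE /chi /= !(mulr0, subrr).
- move=> i j _; rewrite free_eval_sum big1 // => k _.
  by rewrite !chiE /chi /= !(mulr0, mul0r).
- move=> i j _; rewrite free_eval_sum big1 // => k _.
  by rewrite !chiE /chi /= !(mulr0, mul0r).
Qed.
HB.instance Definition _ := GRing.PzSemiRing_isNonZero.Build Urs Urs_oner_neq0.
HB.instance Definition _ :=
  GRing.Lmodule_isLalgebra.Build K Urs (@presented_scaleAl _ _ U_rel).
HB.instance Definition _ :=
  GRing.LSemiAlgebra_isSemiAlgebra.Build K Urs (@presented_scaleAr _ _ U_rel).

Definition U_e i : Urs := presented_pi U_rel (e i).
Definition U_f i : Urs := presented_pi U_rel (f i).
Definition U_w i : Urs := presented_pi U_rel (w i).
Definition U_wV i : Urs := presented_pi U_rel (wV i).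
Definition U_w' i : Urs := presented_pi U_rel (w' i).
Definition U_w'V i : Urs := presented_pi U_rel (w'V i).

Definition int_power (a aV : Urs) (z : int) : Urs :=
  match z with Posz m => a ^+ m | Negz m => aV ^+ m.+1 end.
(* omega_mu and omega'_mu for mu = root_comb k *)
Definition U_omega (k : 'I_n -> int) : Urs :=
  \prod_i int_power (U_w i) (U_wV i) (k i).
Definition U_omega' (k : 'I_n -> int) : Urs :=
  \prod_i int_power (U_w' i) (U_w'V i) (k i).

Definition U_ge : Urs -> Prop := generated_subalg (fun u =>
  exists i, [\/ u = U_e i, u = U_w i | u = U_wV i]).
Definition U_le : Urs -> Prop := generated_subalg (fun u =>
  exists i, [\/ u = U_f i, u = U_w' i | u = U_w'V i]).

Definition U_plus mu : Urs -> Prop := linear_span (fun u =>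
  exists2 l : seq 'I_n, mu = \sum_(i <- l) alpha i & u = \prod_(i <- l) U_e i).
(* the homogeneous component of U^- of degree - mu *)
Definition U_minus mu : Urs -> Prop := linear_span (fun u =>
  exists2 l : seq 'I_n, mu = \sum_(i <- l) alpha i & u = \prod_(i <- l) U_f i).

Record is_coproduct (Delta : Urs -> tensor_alg Urs Urs) : Prop := {
  coproduct_w i : Delta (U_w i) = tens (U_w i) (U_w i);
  coproduct_wV i : Delta (U_wV i) = tens (U_wV i) (U_wV i);
  coproduct_w' i : Delta (U_w' i) = tens (U_w' i) (U_w' i);
  coproduct_w'V i : Delta (U_w'V i) = tens (U_w'V i) (U_w'V i);
  coproduct_e i : Delta (U_e i) = tens (U_e i) 1 + tens (U_w i) (U_e i);
  coproduct_f i : Delta (U_f i) = tens 1 (U_f i) + tens (U_f i) (U_w' i)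
}.

Definition tens_in (P : Urs -> Prop) (ts : seq (Urs * Urs)) : Prop :=
  forall p, p \in ts -> P p.1 /\ P p.2.

(* [pair y x] is only constrained, and only meaningful, for y in U^<= and
   x in U^>=. *)
Record is_pairing (Delta : Urs -> tensor_alg Urs Urs)
    (pair : Urs -> Urs -> K) : Prop := {
  pairing_linearl c y y' x : U_le y -> U_le y' -> U_ge x ->
    pair (c *: y + y') x = c * pair y x + pair y' x;
  pairing_linearr c y x x' : U_le y -> U_ge x -> U_ge x' ->
    pair y (c *: x + x') = c * pair y x + pair y x';
  pairing_mull y y' x ts : U_le y -> U_le y' -> U_ge x ->
    tens_in U_ge ts -> Delta x = tens_sum ts ->
    pair (y * y') x = \sum_(p <- ts) pair y p.1 * pair y' p.2;
  pairing_mulr y x x' ts : U_le y -> U_ge x -> U_ge x' ->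
    tens_in U_le ts -> Delta y = tens_sum ts ->
    pair y (x * x') = \sum_(p <- ts) pair p.1 x' * pair p.2 x;
  pairing_fw i j : pair (U_f i) (U_w j) = 0;
  pairing_w'e i j : pair (U_w' i) (U_e j) = 0;
  pairing_fe i j : pair (U_f i) (U_e j) = (i == j)%:R / (s_ i - r_ i);
  pairing_w'w k l : pair (U_omega' k) (U_omega l) =
    wpair (root_comb k) (root_comb l)
}.

Record is_dual_bases (pair : Urs -> Urs -> K) (mu : 'rV[int]_n) (d : nat)
    (x y : 'I_d -> Urs) : Prop := {
  dual_bases_plus : is_basis (U_plus mu) x;
  dual_bases_minus : is_basis (U_minus mu) y;
  dual_bases_pair (i j : 'I_d) : pair (y i) (x j) = (i == j)%:R
}.

(* V = K^(2n) with v_1, ..., v_(2n) the standard basis of column vectors.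
   Matrix indices are 0-based: [E i j] is E_(i+1, j+1) and
   [op i] is (i+1)' - 1. *)
Local Notation N := (2 * n)%N.

Definition op (i : nat) : nat := (N - i.+1)%N.
Definition E (i j : nat) : 'M[K]_N :=
  \matrix_(k, l) ((k == i :> nat) && (l == j :> nat))%:R.
Definition V_weight (k : nat) : 'rV[int]_n :=
  if (k < n)%N then eps k else - eps (op k).

Definition V_e i : 'M[K]_N :=
  if (i.+1 < n)%N then E i i.+1 - E (op i.+1) (op i) else E i (op i).
Definition V_f i : 'M[K]_N :=
  if (i.+1 < n)%N then E i.+1 i - (r * s)^-1 *: E (op i) (op i.+1)
  else (r * s)^-1 *: E (op i) i.
Definition V_w i : 'M[K]_N :=
  \sum_(k < N) wpair (V_weight k) (alpha i) *: E k k.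
Definition V_w' i : 'M[K]_N :=
  \sum_(k < N) (wpair (alpha i) (V_weight k))^-1 *: E k k.

Record is_first_fundamental (rho : Urs -> 'M[K]_N) : Prop := {
  fundamental_e i : rho (U_e i) = V_e i;
  fundamental_f i : rho (U_f i) = V_f i;
  fundamental_w i : rho (U_w i) = V_w i;
  fundamental_w' i : rho (U_w' i) = V_w' i
}.

(* Operators on V (x) V are matrices of size N * N, and [A *t B] is the
   operator v (x) w |-> A v (x) B w. *)
Definition V2_action (rho : Urs -> 'M[K]_N) (ts : seq (Urs * Urs)) :
    'M[K]_(N * N) := \sum_(p <- ts) rho p.1 *t rho p.2.

Definition is_V2_isomorphism (Delta : Urs -> tensor_alg Urs Urs)
    (rho : Urs -> 'M[K]_N) (M : 'M[K]_(N * N)) : Prop :=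
  M \in unitmx /\
  forall u ts, Delta u = tens_sum ts ->
    M *m V2_action rho ts = V2_action rho ts *m M.

Definition tau_VV : 'M[K]_(N * N) := \sum_(k < N) \sum_(l < N) E k l *t E l k.

Definition f_weight lambda mu : K := (wpair mu lambda)^-1.
Definition ftilde_VV : 'M[K]_(N * N) :=
  \sum_(k < N) \sum_(l < N)
    f_weight (V_weight k) (V_weight l) *: (E k k *t E l l).

(* Only finitely many terms are nonzero: products of 2n or more e_i's act by 0
   on V. *)
Definition Theta_VV (rho : Urs -> 'M[K]_N) (dim : 'rV[int]_n -> nat)
    (x y : forall mu, 'I_(dim mu) -> Urs) : 'M[K]_(N * N) :=
  1%:M + \sum_(mu \in [set mu | positive_weight mu])
    \sum_(i < dim mu) rho (y mu i) *t rho (x mu i).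

Definition Rhat_VV rho dim x y : 'M[K]_(N * N) :=
  @Theta_VV rho dim x y *m ftilde_VV *m tau_VV.

Definition sigma (i : nat) : int := if (i < n)%N then 1 else -1.
Definition t_ (i : nat) : K :=
  if (i < n)%N then s ^ (i.+1%:Z - n%:Z - 1) else - r ^ (n%:Z - i.+1%:Z).
Definition a_ (i j : nat) : K :=
  if ((i < j) && (i < op j) || (j < i) && (op j < i))%N
  then (rh * sh) ^ (- (sigma i * sigma j))
  else (rh * sh) ^ (sigma i * sigma j).

Definition Rhat : 'M[K]_(N * N) :=
    (rh^-1 * sh) *: (\sum_(i < N) E i i *t E i i)
  + (rh * sh^-1) *: (\sum_(i < N) E i (op i) *t E (op i) i)
  + \sum_(i < N) \sum_(j < N | (j != i :> nat) && (j != op i :> nat))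
      a_ i j *: (E i j *t E j i)
  + ((s - r) * (rh * sh)^-1) *: (\sum_(i < n)
      (r ^ (n%:Z + 1 - i.+1%:Z) * s ^ (i.+1%:Z - n%:Z - 1) + 1)
        *: (E (op i) (op i) *t E i i))
  + ((s - r) * (rh * sh)^-1) *: (\sum_(i < N)
      \sum_(j < N | (j < i)%N && (j != op i :> nat)) E i i *t E j j)
  + ((r - s) * (rh * sh)^-1) *: (\sum_(i < N)
      \sum_(j < N | (i < j)%N && (j != op i :> nat))
        (t_ i / t_ j) *: (E (op i) j *t E i (op j))).
End QuantumGroup.

(* Main.v *)
(** Theta is built from dual bases, so the pairing formulas for [y, x e_i] and
    [y, e_i x] turn the commutators [e_i, y_k] into the identity
      (e_i (x) 1 + w_i (x) e_i) Theta = Theta (e_i (x) 1 + w'_i (x) e_i),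
    and hence Rhat_VV = Theta ftilde tau commutes with Delta(e_i) on V (x) V.
    An operator X on V (x) V intertwining the Delta(e_i) is determined by its
    rows of the form v_1 (x) v_l: the component of Delta(e_i) X at v_k (x) v_l
    expresses the rows at v_(k+1) (x) v_l through those at v_k.  Theta has unit
    rows there, because rho(f_i) lowers, so three uses of this uniqueness
    suffice:
    - Rhat_VV = Rhat, once the explicit Rhat is seen to commute with Delta(e_i)
      and to have the same first rows;
    - Rhat_VV commutes with Delta(w_i) and Delta(w'_i);
    - [Delta(f_j), Rhat_VV] = 0, since [Delta(e_i), Delta(f_j)] lies in the torus.
    Invertibility holds as Theta is lower unitriangular. *)

Require Import Defs.
From HB Require Import structures.
From mathcomp Require Import all_boot all_order all_algebra finmap.
From mathcomp Require Import fraction complex mxtens.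
From mathcomp Require Import boolp classical_sets fsbigop reals.
From mathcomp Require Import monalg zify ring.
Set Implicit Arguments.
Unset Strict Implicit.
Unset Printing Implicit Defensive.
Import GRing.Theory.
Local Open Scope ring_scope.

(** * Matrix representations of presented algebras *)

(** The Theta identity is an adjunction. For y in U^- of degree -mu there are skew derivatives p and
    z with [e_i, y] = (z w'_i - w_i p) / (s_i - r_i), and the same p and z w'_i represent, up to
    that constant, the functionals (y, e_i x) and (y, x e_i) of x. Expanding the derivatives of one
    dual basis in the dual basis of degree mu - alpha_i turns the commutator with e_i on the left
    leg into multiplication by e_i on the right leg. No explicit basis and no value of a Theta_mu is
    ever computed. A direct treatment of f_j would require a second theory of skew derivatives, on
    U^+. The detour through [e_i, f_j] replaces it by one more use of uniqueness, and no
    decomposition of V (x) V is needed. On the explicit side, Rhat sends v_k (x) v_l to a scaled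
    flip, minus a multiple of v_k (x) v_l if l < k, plus, when l = k', a multiple of a truncation of
    the sum of the t_i v_(i') (x) v_i. The t_i are the coefficients that make the full sum
    invariant. *)

Section MatrixEvaluation.
Variables (K : fieldType) (G : choiceType) (m : nat) (h : G -> 'M[K]_m).
Local Notation malgebra := {malg K[{fmonom G}]}.
Local Notation freealg := (free_alg K G).

Definition word_mx (w : {fmonom G}) : 'M[K]_m :=
  \prod_(g <- (w : seq G)) h g.

Lemma word_mxM v w : word_mx (mmul v w) = word_mx v * word_mx w.
Proof. by rewrite /word_mx fmM big_cat. Qed.

Definition free_mx (x : freealg) : 'M[K]_m :=
  \sum_(w <- msupp (x : malgebra)) mcoeff w (x : malgebra) *: word_mx w.

(** Supports vary with the element; summing over a common finite superset makes the evaluations of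
    different elements comparable. *)
Lemma free_mxEw (d : {fset {fmonom G}}) (x : malgebra) :
  (msupp x `<=` d)%fset ->
  free_mx x = \sum_(w <- d) mcoeff w x *: word_mx w.
Proof.
move=> le; rewrite /free_mx (big_fset_incl _ le) //= => w _ /mcoeff_outdom ->.
by rewrite scale0r.
Qed.

Lemma free_mx_linear c x y : free_mx (c *: x + y) = c *: free_mx x + free_mx y.
Proof.
pose d := (msupp (c *: (x : malgebra) + y) `|` msupp (x : malgebra)
           `|` msupp (y : malgebra))%fset.
rewrite 3?(@free_mxEw d) ?fsubsetUr // /d -?fsetUA ?fsubsetUl //; last first.
  by rewrite fsetUCA fsubsetUl.
rewrite scaler_sumr -big_split /=; apply: eq_bigr => w _.
by rewrite mcoeffD mcoeffZ scalerDl scalerA.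
Qed.

Lemma free_mx0 : free_mx 0 = 0.
Proof. by rewrite /free_mx msupp0 big_seq_fset0. Qed.
Lemma free_mxD x y : free_mx (x + y) = free_mx x + free_mx y.
Proof. by rewrite -[x]scale1r free_mx_linear !scale1r. Qed.
Lemma free_mxZ c x : free_mx (c *: x) = c *: free_mx x.
Proof. by rewrite -[c *: x]addr0 free_mx_linear free_mx0 addr0. Qed.
Lemma free_mxB x y : free_mx (x - y) = free_mx x - free_mx y.
Proof. by rewrite addrC -scaleN1r free_mx_linear scaleN1r addrC. Qed.
Lemma free_mx_sum (I : Type) (l : seq I) (F : I -> freealg) :
  free_mx (\sum_(i <- l) F i) = \sum_(i <- l) free_mx (F i).
Proof. by elim/big_rec2: _ => [|i a b _ <-]; rewrite ?free_mx0 ?free_mxD. Qed.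

Lemma free_mxU c w : free_mx (<< c *g w >> : malgebra) = c *: word_mx w.
Proof. by rewrite (free_mxEw msuppU_le) big_seq_fset1 mcoeffUU. Qed.

Lemma free_mx1 : free_mx 1 = 1.
Proof.
have -> : (1 : freealg) = (<< 1 *g mone >> : malgebra) by [].
by rewrite free_mxU scale1r /word_mx fm1 big_nil.
Qed.

Lemma free_mx_gen g : free_mx (fgen K g) = h g.
Proof. by rewrite /fgen -lock free_mxU scale1r /word_mx fmU big_seq1. Qed.

Lemma free_mxM x y : free_mx (x * y) = free_mx x * free_mx y.
Proof.
change (free_mx (free_mul x y) = free_mx x * free_mx y).
rewrite free_mulE malgME [in RHS]/free_mx.
rewrite (@free_mx_sum _ _ (fun _ => _ : freealg)) mulr_suml.
apply: eq_bigr => v _.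
rewrite (@free_mx_sum _ _ (fun _ => _ : freealg)) mulr_sumr.
apply: eq_bigr => w _.
by rewrite free_mxU word_mxM -[RHS]/(_ *m _) -scalemxAl -scalemxAr scalerA.
Qed.

Variable rel : freealg -> Prop.
Hypothesis rel0 : forall x, rel x -> free_mx x = 0.

Definition presented_mx (u : presented rel) : 'M[K]_m :=
  free_mx (presented_repr u).

(** Two representatives of a class differ by an element of the relation ideal, and evaluation kills
    this ideal because it kills the relations. *)
Lemma presented_mx_pi x : presented_mx (presented_pi rel x) = free_mx x.
Proof.
have ideal0 y : relation_ideal rel y -> free_mx y = 0.
  elim=> [|{}y z _ Hy _ Hz|a {}y b /rel0 Hy]; first exact: free_mx0.
    by rewrite free_mxD Hy Hz addr0.
  by rewrite !free_mxM Hy mulr0 mul0r.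
by apply/esym/eqP; rewrite -subr_eq0 -free_mxB ideal0 //; apply: presented_reprP.
Qed.

Lemma presented_mx_linear c u v :
  presented_mx (c *: u + v) = c *: presented_mx u + presented_mx v.
Proof.
elim/presented_ind: u => x; elim/presented_ind: v => y.
by rewrite -linearP !presented_mx_pi free_mx_linear.
Qed.

Lemma presented_mxM u v : presented_mx (u * v) = presented_mx u * presented_mx v.
Proof.
elim/presented_ind: u => x; elim/presented_ind: v => y.
by rewrite -rmorphM !presented_mx_pi free_mxM.
Qed.
End MatrixEvaluation.

Lemma free_alg_ind (K : fieldType) (G : choiceType) (P : free_alg K G -> Prop) :
  P 1 -> (forall g, P (fgen K g)) ->
  (forall c x y, P x -> P y -> P (c *: x + y)) ->
  (forall x y, P x -> P y -> P (x * y)) -> forall x, P x.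
Proof.
move=> P1 Pgen Plin Pmul x.
have P0 : P 0 by rewrite -(addNr 1) -scaleN1r; apply: Plin.
have Pw (w : {fmonom G}) : P (<< 1 *g w >> : {malg K[{fmonom G}]}).
  rewrite -[w]fmK; elim: (w : seq G) => [|g l IHl].
    by rewrite -fmoneE; exact: P1.
  rewrite (_ : << 1 *g FMonom (g :: l) >> =
    (fgen K g : free_alg K G) * (<< 1 *g FMonom l >> : {malg K[{fmonom G}]})).
    by apply: Pmul.
  change (<< 1 *g FMonom (g :: l) >> = free_mul (fgen K g)
    (<< 1 *g FMonom l >> : {malg K[{fmonom G}]})).
  rewrite free_mulE /fgen -lock malgM_def fgmulUU mulr1 fmuE.
  congr mkmalgU; exact: (esym (fmmulE (FMonom [:: g]) (FMonom l))).
rewrite [x](@monalgE {fmonom G}).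
elim/big_rec: _ => // w y _ Py.
rewrite -[mkmalgU _ _]/(mkmalgU w (mcoeff w (x : {malg K[{fmonom G}]}))).
by rewrite -[mcoeff w _]mulr1 -malg_scaleU; apply: Plin.
Qed.

Section PresentedInduction.
Variables (K : fieldType) (G : choiceType) (rel : free_alg K G -> Prop).

Lemma presented_pi_eq x y : rel (x - y) -> presented_pi rel x = presented_pi rel y.
Proof.
move=> Rxy; apply/presented_eqP.
by rewrite -[_ - _]mul1r -[_ * (_ - _)]mulr1; apply: relation_idealM.
Qed.

(** Used to extend commutation with [Rhat_VV] from the generators to all of U. *)
Lemma presented_gen_ind (P : presented rel -> Prop) :
  P 1 -> (forall g, P (presented_pi rel (fgen K g))) ->
  (forall c u v, P u -> P v -> P (c *: u + v)) ->
  (forall u v, P u -> P v -> P (u * v)) -> forall u, P u.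
Proof.
move=> P1 Pgen Plin Pmul; elim/presented_ind; elim/free_alg_ind.
- by rewrite rmorph1.
- exact: Pgen.
- by move=> c x y Px Py; rewrite linearP; apply: Plin.
- by move=> x y Px Py; rewrite rmorphM; apply: Pmul.
Qed.
End PresentedInduction.

(** * Tensor products of matrix representations *)

Section TensorProduct.
Variables (K : fieldType) (A B : algType K).
Implicit Types (a : A) (b : B).
Local Notation tens := (@tens K A B).

Lemma tensZl c a b : tens (c *: a) b = c *: tens a b.
Proof.
by rewrite /Defs.tens -linearZ; apply: presented_pi_eq; apply: tensor_rel_scalel.
Qed.
Lemma tensM a a' b b' : tens a b * tens a' b' = tens (a * a') (b * b').
Proof.
by rewrite /Defs.tens -rmorphM; apply: presented_pi_eq; apply: tensor_rel_mul.
Qed.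
Lemma tens11 : tens 1 1 = 1.
Proof. by apply: presented_pi_eq; apply: tensor_rel_one. Qed.

Lemma tens_sum_cat ts us : tens_sum (ts ++ us) = tens_sum ts + tens_sum us :>
  tensor_alg A B.
Proof. exact: big_cat. Qed.

Lemma tens_sum1 a b : tens_sum [:: (a, b)] = tens a b.
Proof. exact: big_seq1. Qed.

Lemma tens_sum2 a b a' b' :
  tens_sum [:: (a, b); (a', b')] = tens a b + tens a' b'.
Proof. by rewrite /tens_sum big_cons big_seq1. Qed.

Lemma tens2_mul a b a' b' ts :
  (tens a b + tens a' b') * tens_sum ts =
  tens_sum ([seq (a * q.1, b * q.2) | q <- ts] ++
            [seq (a' * q.1, b' * q.2) | q <- ts]).
Proof.
rewrite tens_sum_cat /tens_sum !big_map mulrDl !mulr_sumr.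
by congr (_ + _); apply: eq_bigr => q _; rewrite tensM.
Qed.

Lemma tens_sumZ c ts :
  c *: (tens_sum ts : tensor_alg A B) = tens_sum [seq (c *: p.1, p.2) | p <- ts].
Proof.
rewrite /tens_sum big_map scaler_sumr; apply: eq_bigr => p _.
by rewrite tensZl.
Qed.

Lemma tens_sumM ts us : (tens_sum ts : tensor_alg A B) * tens_sum us =
  tens_sum [seq (p.1 * q.1, p.2 * q.2) | p <- ts, q <- us].
Proof.
rewrite /tens_sum big_allpairs_dep mulr_suml; apply: eq_bigr => p _.
by rewrite mulr_sumr; apply: eq_bigr => q _; rewrite tensM.
Qed.

Variables (m p : nat) (rA : {lrmorphism A -> 'M[K]_m}) (rB : {lrmorphism B -> 'M[K]_p}).

Definition tensor_mx : tensor_alg A B -> 'M[K]_(m * p) :=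
  @presented_mx K (A * B)%type (m * p) (fun q => rA q.1 *t rB q.2) (@tensor_rel K A B).

Lemma tensor_mx_rel x : tensor_rel x ->
  free_mx (fun q : A * B => rA q.1 *t rB q.2) x = 0.
Proof.
case=> *; rewrite ?(free_mxB, free_mxM, free_mxZ, free_mx1, free_mx_gen) /=.
- by apply/matrixP=> i j; rewrite raddfD !mxE mulrDl addrAC addrK subrr.
- by apply/matrixP=> i j; rewrite raddfD !mxE mulrDr addrAC addrK subrr.
- by apply/matrixP=> i j; rewrite linearZ !mxE mulrA subrr.
- by apply/matrixP=> i j; rewrite linearZ !mxE mulrCA subrr.
- by rewrite -[_ * _]/(_ *m _) tensmx_mul !rmorphM subrr.
(* The Kronecker product of two identities is the identity because its indices correspond
   bijectively to pairs of indices. *)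
- rewrite !rmorph1; apply/eqP; rewrite subr_eq0; apply/eqP/matrixP=> i j.
  case: (mxtens_indexP i) => i1 i2; case: (mxtens_indexP j) => j1 j2.
  rewrite tensmxE !mxE -natrM mulnb -xpair_eqE.
  by rewrite (can_eq (@mxtens_indexK _ _) (i1, i2) (j1, j2)).
Qed.

Lemma tensor_mx_linear c u v :
  tensor_mx (c *: u + v) = c *: tensor_mx u + tensor_mx v.
Proof. exact/presented_mx_linear/tensor_mx_rel. Qed.
Lemma tensor_mxM u v : tensor_mx (u * v) = tensor_mx u *m tensor_mx v.
Proof. exact/presented_mxM/tensor_mx_rel. Qed.
Lemma tensor_mx_tens a b : tensor_mx (tens a b) = rA a *t rB b.
Proof. by rewrite /tensor_mx presented_mx_pi ?free_mx_gen //; apply: tensor_mx_rel. Qed.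
Lemma tensor_mx1 : tensor_mx 1 = 1%:M.
Proof.
by rewrite -(rmorph1 (presented_pi _)) /tensor_mx presented_mx_pi ?free_mx1 //;
  exact: tensor_mx_rel.
Qed.

Lemma tensor_mxD u v : tensor_mx (u + v) = tensor_mx u + tensor_mx v.
Proof. by rewrite -[u]scale1r tensor_mx_linear !scale1r. Qed.
Lemma tensor_mx0 : tensor_mx 0 = 0.
Proof. by apply: (addrI (tensor_mx 0)); rewrite -tensor_mxD !addr0. Qed.
(** Consequently [V2_action rho ts] depends only on the tensor that [ts] represents, as the
    isomorphism claim, which ranges over all such lists, requires. *)
Lemma tensor_mx_sum ts : tensor_mx (tens_sum ts) = \sum_(q <- ts) rA q.1 *t rB q.2.
Proof.
rewrite /tens_sum; elim/big_rec2: _ => [|q a b _ <-]; first exact: tensor_mx0.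
by rewrite tensor_mxD tensor_mx_tens.
Qed.
End TensorProduct.

(** * The coproduct and the pairing *)

Section QuantumGroup.
Variables (K : fieldType) (rh sh : K) (n : nat).
Local Notation U := (Urs rh sh n).
Local Notation e := (U_e rh sh).
Local Notation f := (U_f rh sh).
Local Notation w := (U_w rh sh).
Local Notation w' := (U_w' rh sh).
Local Notation wV := (U_wV rh sh).
Local Notation w'V := (U_w'V rh sh).
Local Notation wpair := (wpair rh sh).
Implicit Types (i j : 'I_n) (l : seq 'I_n) (lambda mu nu : 'rV[int]_n).

Lemma form20r lambda : form2 lambda 0 = 0.
Proof. by rewrite /form2 big1 // => i _; rewrite big1 // => j _;
  rewrite mxE !mulr0. Qed.
Lemma form20l lambda : form2 0 lambda = 0.
Proof. by rewrite /form2 big1 // => i _; rewrite big1 // => j _;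
  rewrite mxE mul0r mulr0. Qed.
Lemma wpair0r lambda : wpair lambda 0 = 1.
Proof. by rewrite /wpair /rform /sform form20r form20l !expr0z divr1. Qed.
Lemma wpair_neq0 lambda mu : rh != 0 -> sh != 0 -> wpair lambda mu != 0.
Proof. by move=> r0 s0; rewrite mulf_neq0 ?invr_neq0 ?expfz_neq0. Qed.

Lemma U_wf i j : w i * f j =
  ((rform rh (alpha j) (alpha i))^-1 * sform sh (alpha i) (alpha j)) *: (f j * w i).
Proof.
by rewrite /U_w /U_f -!rmorphM -linearZ; apply: presented_pi_eq; apply: U_rel_wf.
Qed.
Lemma U_w'f i j : w' i * f j =
  (rform rh (alpha i) (alpha j) * (sform sh (alpha j) (alpha i))^-1) *: (f j * w' i).
Proof.
by rewrite /U_w' /U_f -!rmorphM -linearZ; apply: presented_pi_eq; apply: U_rel_w'f.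
Qed.
Lemma U_we i j : w i * e j =
  (rform rh (alpha j) (alpha i) * (sform sh (alpha i) (alpha j))^-1) *: (e j * w i).
Proof.
by rewrite /U_w /U_e -!rmorphM -linearZ; apply: presented_pi_eq; apply: U_rel_we.
Qed.
Lemma U_w'e i j : w' i * e j =
  ((rform rh (alpha i) (alpha j))^-1 * sform sh (alpha j) (alpha i)) *: (e j * w' i).
Proof.
by rewrite /U_w' /U_e -!rmorphM -linearZ; apply: presented_pi_eq; apply: U_rel_w'e.
Qed.
Lemma U_ef i j : e i * f j - f j * e i =
  ((i == j)%:R / (r_ rh i - s_ sh i)) *: (w i - w' i).
Proof.
by rewrite /U_w /U_w' /U_e /U_f -!rmorphM -!rmorphB -linearZ; apply: presented_pi_eq;
  apply: U_rel_ef.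
Qed.
Lemma U_wwV i : w i * wV i = 1.
Proof.
by rewrite /U_w /U_wV -rmorphM; apply: presented_pi_eq; apply: U_rel_wV.
Qed.
Lemma U_w'w'V i : w' i * w'V i = 1.
Proof.
by rewrite /U_w' /U_w'V -rmorphM; apply: presented_pi_eq; apply: U_rel_w'V.
Qed.
Lemma U_wVw i : wV i * w i = 1.
Proof.
rewrite -(U_wwV i) /U_w /U_wV -!rmorphM; apply: presented_pi_eq.
exact: U_rel_torus.
Qed.
Lemma U_w'Vw' i : w'V i * w' i = 1.
Proof.
rewrite -(U_w'w'V i) /U_w' /U_w'V -!rmorphM; apply: presented_pi_eq.
exact: U_rel_torus.
Qed.

Lemma subalg0 (A : algType K) (S : A -> Prop) : generated_subalg S 0.
Proof.
rewrite -(addNr 1) -scaleN1r.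
by apply: generated_subalg_linear; apply: generated_subalg_one.
Qed.

Lemma subalgZ (A : algType K) (S : A -> Prop) c a :
  generated_subalg S a -> generated_subalg S (c *: a).
Proof.
move=> Sa; rewrite -[_ *: _]addr0.
by apply: generated_subalg_linear => //; apply: subalg0.
Qed.

Section LinearSpan.
Variables (A : algType K) (S T : A -> Prop).
Lemma linear_span_gen a : S a -> linear_span S a.
Proof.
by move=> Sa; rewrite -[a]addr0 -[a]scale1r; apply: linear_spanP => //;
  exact: linear_span0.
Qed.
Lemma linear_span_linear c a b :
  linear_span S a -> linear_span S b -> linear_span S (c *: a + b).
Proof.
move=> Sa Sb; elim: Sa => [|d x y Sx _ Sy]; first by rewrite scaler0 add0r.
by rewrite scalerDr scalerA -addrA; apply: linear_spanP.
Qed.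
Lemma linear_spanZ c a : linear_span S a -> linear_span S (c *: a).
Proof.
move=> Sa; rewrite -[_ *: _]addr0.
by apply: linear_span_linear => //; exact: linear_span0.
Qed.
Lemma linear_span_subalg a : (forall b, S b -> generated_subalg T b) ->
  linear_span S a -> generated_subalg T a.
Proof.
move=> ST; elim=> [|d x y Sx _ Sy]; first exact: subalg0.
by apply: generated_subalg_linear => //; exact: ST.
Qed.
End LinearSpan.

Lemma U_le_f i : U_le (f i).
Proof. by apply: generated_subalg_gen; exists i; constructor 1. Qed.
Lemma U_le_w' i : U_le (w' i).
Proof. by apply: generated_subalg_gen; exists i; constructor 2. Qed.
Lemma U_ge_e i : U_ge (e i).
Proof. by apply: generated_subalg_gen; exists i; constructor 1. Qed.
Lemma U_ge_w i : U_ge (w i).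
Proof. by apply: generated_subalg_gen; exists i; constructor 2. Qed.
Lemma U_le_1 : U_le (1 : U). Proof. exact: generated_subalg_one. Qed.
Lemma U_ge_1 : U_ge (1 : U). Proof. exact: generated_subalg_one. Qed.
Lemma U_leM (u v : U) : U_le u -> U_le v -> U_le (u * v).
Proof. exact: generated_subalg_mul. Qed.
Lemma U_geM (u v : U) : U_ge u -> U_ge v -> U_ge (u * v).
Proof. exact: generated_subalg_mul. Qed.
Lemma U_le0 : U_le (0 : U). Proof. exact: subalg0. Qed.
Lemma U_ge0 : U_ge (0 : U). Proof. exact: subalg0. Qed.
Lemma U_leZ c (u : U) : U_le u -> U_le (c *: u).
Proof. exact: subalgZ. Qed.
Lemma U_le_linear c (u v : U) : U_le u -> U_le v -> U_le (c *: u + v).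
Proof. exact: generated_subalg_linear. Qed.
Lemma U_ge_linear c (u v : U) : U_ge u -> U_ge v -> U_ge (c *: u + v).
Proof. exact: generated_subalg_linear. Qed.
Hint Resolve U_le_f U_le_w' U_ge_e U_ge_w U_le_1 U_ge_1 U_leM U_geM U_le0 U_ge0 U_leZ
  U_le_linear U_ge_linear : core.

Lemma U_le_word l : U_le (\prod_(i <- l) f i).
Proof. by elim/big_rec: _ => // i u _; apply: U_leM. Qed.
Lemma U_ge_word l : U_ge (\prod_(i <- l) e i).
Proof. by elim/big_rec: _ => // i u _; apply: U_geM. Qed.

Lemma U_minus_le mu (y : U) : U_minus mu y -> U_le y.
Proof. by apply: linear_span_subalg => _ [l _ ->]; apply: U_le_word. Qed.
Lemma U_plus_ge mu (x : U) : U_plus mu x -> U_ge x.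
Proof. by apply: linear_span_subalg => _ [l _ ->]; apply: U_ge_word. Qed.

Lemma U_minus_word l : U_minus (\sum_(i <- l) alpha i) (\prod_(i <- l) f i).
Proof. by apply: linear_span_gen; exists l. Qed.

Lemma U_minusM j nu (y : U) : U_minus nu y -> U_minus (alpha j + nu) (f j * y).
Proof.
move=> Uy; elim: {y}Uy => [|c u v [l nuE ->] _ IH].
  by rewrite mulr0; apply: linear_span0.
rewrite mulrDr -scalerAr; apply: linear_spanP => //.
by exists (j :: l); rewrite big_cons // nuE.
Qed.

Variable Delta : {lrmorphism U -> tensor_alg U U}.
Hypothesis Delta_cop : is_coproduct Delta.

Lemma tens_in_cons (P : U -> Prop) a b ts :
  P a -> P b -> tens_in P ts -> tens_in P ((a, b) :: ts).
Proof. by move=> Pa Pb Pts q; rewrite inE => /predU1P[->|/Pts]. Qed.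

Lemma tens_in_cat P ts us : tens_in P ts -> tens_in P us ->
  tens_in P (ts ++ us : seq (U * U)).
Proof. by move=> Pts Pus q; rewrite mem_cat => /orP[/Pts|/Pus]. Qed.

Lemma tens_in_map (P : U -> Prop) (g h : U -> U) ts :
  (forall u, P u -> P (g u)) -> (forall u, P u -> P (h u)) -> tens_in P ts ->
  tens_in P [seq (g q.1, h q.2) | q <- ts].
Proof. by move=> Pg Ph Pts _ /mapP[q /Pts[? ?] ->]; split; [apply: Pg|apply: Ph]. Qed.

(** The multiplicative axioms of the pairing accept only expressions of Delta u whose legs all lie
    in the same half, so such an expression has to be produced; sums and products preserve its
    existence. *)
Lemma subalg_coproduct (S : U -> Prop) :
  (forall u, S u -> exists2 ts, tens_in (generated_subalg S) ts & Delta u = tens_sum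
    ts) ->
  forall u, generated_subalg S u ->
    exists2 ts, tens_in (generated_subalg S) ts & Delta u = tens_sum ts.
Proof.
move=> gen u; elim=> [//||c a b _ [ts Sts Da] _ [us Sus Db]|a b _ [ts Sts Da] _ [us
  Sus Db]].
- exists [:: (1, 1)]; first by move=> q; rewrite inE => /eqP->; split;
  apply: generated_subalg_one.
  by rewrite rmorph1 tens_sum1 tens11.
- exists ([seq (c *: q.1, q.2) | q <- ts] ++ us).
    apply: tens_in_cat => //; apply: (@tens_in_map _ (fun u => c *: u) id) => // v.
    exact: subalgZ.
  by rewrite linearP /= tens_sum_cat -tens_sumZ Da Db.
- exists [seq (p.1 * q.1, p.2 * q.2) | p <- ts, q <- us].
    move=> _ /allpairsP[[p q] /= [/Sts[? ?] /Sus[? ?] ->]].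
    by split; apply: generated_subalg_mul.
  by rewrite rmorphM /= -tens_sumM Da Db.
Qed.

Lemma U_ge_coproduct x : U_ge x ->
  exists2 ts, tens_in (@U_ge K rh sh n) ts & Delta x = tens_sum ts.
Proof.
have U_ge_wV i : U_ge (wV i).
  by apply: generated_subalg_gen; exists i; constructor 3.
suff gen u : (exists i, [\/ u = e i, u = w i | u = wV i]) ->
    exists2 ts, tens_in (@U_ge K rh sh n) ts & Delta u = tens_sum ts.
  exact: subalg_coproduct gen _.
move=> [i [->|->|->]].
- exists [:: (e i, 1); (w i, e i)]; first by do 2!apply: tens_in_cons => //.
  by rewrite (coproduct_e Delta_cop) tens_sum2.
- exists [:: (w i, w i)]; first by apply: tens_in_cons.
  by rewrite (coproduct_w Delta_cop) tens_sum1.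
- exists [:: (wV i, wV i)]; first by apply: tens_in_cons.
  by rewrite (coproduct_wV Delta_cop) tens_sum1.
Qed.

Lemma U_le_coproduct y : U_le y ->
  exists2 ts, tens_in (@U_le K rh sh n) ts & Delta y = tens_sum ts.
Proof.
have U_le_w'V i : U_le (w'V i).
  by apply: generated_subalg_gen; exists i; constructor 3.
suff gen u : (exists i, [\/ u = f i, u = w' i | u = w'V i]) ->
    exists2 ts, tens_in (@U_le K rh sh n) ts & Delta u = tens_sum ts.
  exact: subalg_coproduct gen _.
move=> [i [->|->|->]].
- exists [:: (1, f i); (f i, w' i)]; first by do 2!apply: tens_in_cons => //.
  by rewrite (coproduct_f Delta_cop) tens_sum2.
- exists [:: (w' i, w' i)]; first by apply: tens_in_cons.
  by rewrite (coproduct_w' Delta_cop) tens_sum1.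
- exists [:: (w'V i, w'V i)]; first by apply: tens_in_cons.
  by rewrite (coproduct_w'V Delta_cop) tens_sum1.
Qed.

Lemma coproduct_f_mul j y ts : Delta y = tens_sum ts ->
  Delta (f j * y) = tens_sum ([seq (1 * q.1, f j * q.2) | q <- ts] ++
                              [seq (f j * q.1, w' j * q.2) | q <- ts]).
Proof. by move=> Dy; rewrite rmorphM /= (coproduct_f Delta_cop) Dy tens2_mul. Qed.
End QuantumGroup.
#[local] Hint Resolve U_le_f U_le_w' U_ge_e U_ge_w U_le_1 U_ge_1 U_leM U_geM U_le0
  U_ge0 U_leZ U_le_linear U_ge_linear : core.

(** * Multiplication by e_i and its adjoint under the pairing *)

Section SkewPairing.
Variables (K : fieldType) (rh sh : K) (n : nat).
Local Notation U := (Urs rh sh n).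
Local Notation e := (U_e rh sh).
Local Notation f := (U_f rh sh).
Local Notation w := (U_w rh sh).
Local Notation w' := (U_w' rh sh).
Local Notation wpair := (wpair rh sh).
Implicit Types (i j : 'I_n) (l : seq 'I_n) (lambda mu nu : 'rV[int]_n).
Variable Delta : {lrmorphism U -> tensor_alg U U}.
Hypothesis Delta_cop : is_coproduct Delta.

Variable pair : U -> U -> K.
Hypothesis pairP : is_pairing Delta pair.
Hypotheses (rh0 : rh != 0) (sh0 : sh != 0).

(** Linearity is available only on the two halves and only for combinations c y + y', so 0 is
    reached as (-1) 1 + 1. *)
Lemma pair0l x : U_ge x -> pair 0 x = 0.
Proof.
move=> Ux; have := pairing_linearl pairP (-1) (U_le_1 _ _ _) (U_le_1 _ _ _) Ux.
by rewrite scaleN1r addNr mulN1r addNr.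
Qed.
Lemma pair0r y : U_le y -> pair y 0 = 0.
Proof.
move=> Uy; have := pairing_linearr pairP (-1) Uy (U_ge_1 _ _ _) (U_ge_1 _ _ _).
by rewrite scaleN1r addNr mulN1r addNr.
Qed.
Lemma pairZl c y x : U_le y -> U_ge x -> pair (c *: y) x = c * pair y x.
Proof.
move=> Uy Ux; rewrite -[c *: y]addr0 (pairing_linearl pairP) ?pair0l ?addr0 //.
Qed.

Lemma pair_suml (I : finType) (c : I -> K) (y : I -> U) x :
  (forall k, U_le (y k)) -> U_ge x ->
  pair (\sum_k c k *: y k) x = \sum_k c k * pair (y k) x.
Proof.
move=> Uy Ux; suff [] : U_le (\sum_k c k *: y k) /\
  pair (\sum_k c k *: y k) x = \sum_k c k * pair (y k) x by [].
elim/big_rec2: _ => [|k a b _ [Ub <-]].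
  by split; [| apply: pair0l].
by split; [apply: U_le_linear | apply: (pairing_linearl pairP)].
Qed.
Lemma pair_sumr (I : finType) (c : I -> K) (x : I -> U) y :
  U_le y -> (forall k, U_ge (x k)) ->
  pair y (\sum_k c k *: x k) = \sum_k c k * pair y (x k).
Proof.
move=> Uy Ux; suff [] : U_ge (\sum_k c k *: x k) /\
  pair y (\sum_k c k *: x k) = \sum_k c k * pair y (x k) by [].
elim/big_rec2: _ => [|k a b _ [Ub <-]].
  by split; [| apply: pair0r].
by split; [apply: U_ge_linear | apply: (pairing_linearr pairP)].
Qed.

Lemma root_comb0 : root_comb (fun=> 0) = 0 :> 'rV[int]_n.
Proof. by rewrite /root_comb big1. Qed.
Lemma root_comb1 j : root_comb (fun i => (i == j)%:R) = alpha j.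
Proof.
rewrite /root_comb (eq_bigr (fun i => if i == j then alpha i else 0)).
  by rewrite -big_mkcond big_pred1_eq.
by move=> i _; case: eqP.
Qed.
Lemma U_omega0 : U_omega rh sh (fun=> 0) = 1 :> U.
Proof. by rewrite /U_omega big1. Qed.
Lemma U_omega'0 : U_omega' rh sh (fun=> 0) = 1 :> U.
Proof. by rewrite /U_omega' big1. Qed.
Lemma U_omega1 j : U_omega rh sh (fun i => (i == j)%:R) = w j.
Proof.
rewrite /U_omega (eq_bigr (fun i => if i == j then w i else 1)).
  by rewrite -big_mkcond big_pred1_eq.
by move=> i _; case: eqP.
Qed.
Lemma U_omega'1 j : U_omega' rh sh (fun i => (i == j)%:R) = w' j.
Proof.
rewrite /U_omega' (eq_bigr (fun i => if i == j then w' i else 1)).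
  by rewrite -big_mkcond big_pred1_eq.
by move=> i _; case: eqP.
Qed.

Lemma pair11 : pair 1 1 = 1.
Proof. by rewrite -{1}U_omega'0 -U_omega0 (pairing_w'w pairP) root_comb0 wpair0r. Qed.
Lemma pair_w'1 j : pair (w' j) 1 = 1.
Proof. by rewrite -U_omega'1 -U_omega0 (pairing_w'w pairP) root_comb0 wpair0r. Qed.
Lemma pair_w'w i j : pair (w' i) (w j) = wpair (alpha i) (alpha j).
Proof. by rewrite -U_omega'1 -U_omega1 (pairing_w'w pairP) !root_comb1. Qed.

Lemma pair_mul_e i y y' : U_le y -> U_le y' ->
  pair (y * y') (e i) = pair y (e i) * pair y' 1 + pair y (w i) * pair y' (e i).
Proof.
move=> Uy Uy'; rewrite (pairing_mull pairP (ts := [:: (e i, 1); (w i, e i)])) //.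
- by rewrite big_cons big_seq1.
- by do 2!apply: tens_in_cons => //.
- by rewrite (coproduct_e Delta_cop) tens_sum2.
Qed.

(** Not an axiom: expanding (w'_i 1, e_i) = 0 along Delta(e_i) leaves (w'_i, w_i)(1, e_i), whose
    first factor is invertible. *)
Lemma pair_1e i : pair 1 (e i) = 0.
Proof.
have := pair_mul_e i (U_le_w' rh sh i) (U_le_1 rh sh n).
rewrite mulr1 (pairing_w'e pairP) mul0r add0r pair_w'w => /esym/eqP.
by rewrite mulf_eq0 (negPf (wpair_neq0 _ _ rh0 sh0)) => /eqP.
Qed.

Local Notation c_ i := ((s_ sh i - r_ rh i)^-1).

Lemma pair_f_e i j y : U_le y ->
  pair (f j * y) (e i) = (j == i)%:R * c_ i * pair y 1.
Proof.
move=> Uy; rewrite pair_mul_e // (pairing_fw pairP) mul0r addr0.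
by rewrite (pairing_fe pairP); case: eqP => [->|_] //; rewrite !mul0r.
Qed.
Lemma pair_w'_e i j y : U_le y ->
  pair (w' j * y) (e i) = wpair (alpha j) (alpha i) * pair y (e i).
Proof.
by move=> Uy; rewrite pair_mul_e // (pairing_w'e pairP) mul0r add0r pair_w'w.
Qed.

(** Induction step for the left derivative. In Delta(f_j y) the terms from 1 (x) f_j pair f_j
    directly with e_i and give the Kronecker delta; those from f_j (x) w'_j let e_i pass to y at the
    cost of the scalar (w'_j, w_i). *)
Lemma pair_f_emul i j y p x : U_le y -> U_le p ->
  (forall x, U_ge x -> pair y (e i * x) = c_ i * pair p x) -> U_ge x ->
  pair (f j * y) (e i * x) =
  c_ i * pair ((j == i)%:R *: y + wpair (alpha j) (alpha i) *: (f j * p)) x.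
Proof.
move=> Uy Up IH Ux; have [ts tsU Dy] := U_le_coproduct Delta_cop Uy.
have [us usU Dx] := U_ge_coproduct Delta_cop Ux.
rewrite (pairing_mulr pairP _ _ _ _ (coproduct_f_mul Delta_cop j Dy)) //; auto;
  last first.
  apply: tens_in_cat; first by apply: (@tens_in_map _ _ _ _ _ ( *%R 1) ( *%R (f j)));
    auto.
  by apply: (@tens_in_map _ _ _ _ _ ( *%R (f j)) ( *%R (w' j))); auto.
rewrite big_cat !big_map /= (pairing_linearl pairP) ?pairZl //; auto.
rewrite mulrDr; congr (_ + _).
  rewrite -[x in RHS]mul1r (pairing_mulr pairP Uy _ _ tsU Dy) // mulrA mulr_sumr.
  rewrite big_seq [RHS]big_seq; apply: eq_bigr => q /tsU[Uq1 Uq2].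
  by rewrite mul1r pair_f_e // mulrCA [c_ i * _]mulrC !mulrA.
rewrite (pairing_mull pairP _ _ _ usU Dx) //.
transitivity (\sum_(q <- ts) \sum_(q' <- us) wpair (alpha j) (alpha i) *
    (pair (f j) q'.1 * (pair q.1 q'.2 * pair q.2 (e i)))).
  rewrite big_seq [RHS]big_seq; apply: eq_bigr => q /tsU[Uq1 Uq2].
  rewrite pair_w'_e // (pairing_mull pairP _ _ _ usU Dx) // mulr_suml.
  by apply: eq_bigr => q' _; ring.
rewrite exchange_big /= !mulr_sumr big_seq [RHS]big_seq.
apply: eq_bigr => q /usU[Uq1 Uq2]; rewrite -!mulr_sumr.
rewrite -(pairing_mulr pairP Uy _ _ tsU Dy) // IH //; ring.
Qed.

(** Mirror image of the previous step: e_i now meets the left legs of Delta(f_j y), and the w' of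
    the second summand survives in the answer. This is why the right derivative enters the pairing
    as z w'_i. *)
Lemma pair_f_mule i j y q x : U_le y -> U_le q ->
  (forall x, U_ge x -> pair y (x * e i) = c_ i * pair q x) -> U_ge x ->
  pair (f j * y) (x * e i) = c_ i * pair (f j * q + (j == i)%:R *: (w' i * y)) x.
Proof.
move=> Uy Uq IH Ux; have [ts tsU Dy] := U_le_coproduct Delta_cop Uy.
have [us usU Dx] := U_ge_coproduct Delta_cop Ux.
rewrite (pairing_mulr pairP _ _ _ _ (coproduct_f_mul Delta_cop j Dy)) //; auto;
  last first.
  apply: tens_in_cat; first by apply: (@tens_in_map _ _ _ _ _ ( *%R 1) ( *%R (f j)));
    auto.
  by apply: (@tens_in_map _ _ _ _ _ ( *%R (f j)) ( *%R (w' j))); auto.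
rewrite big_cat !big_map /= [_ + (_ *: _) in RHS]addrC.
rewrite (pairing_linearl pairP); auto.
rewrite addrC mulrDr; congr (_ + _).
  rewrite (pairing_mull pairP _ _ _ usU Dx); auto.
  transitivity (\sum_(p <- ts) \sum_(p' <- us)
      (j == i)%:R * c_ i * (pair (w' j) p'.1 * (pair p.1 1 * pair p.2 p'.2))).
    rewrite big_seq [RHS]big_seq; apply: eq_bigr => p /tsU[Up1 Up2].
    rewrite pair_f_e // (pairing_mull pairP _ _ _ usU Dx) // mulr_sumr.
    by apply: eq_bigr => p' _; ring.
  rewrite exchange_big /= !mulr_sumr big_seq [RHS]big_seq.
  apply: eq_bigr => p /usU[Up1 Up2]; rewrite -!mulr_sumr.
  rewrite -(pairing_mulr pairP Uy _ _ tsU Dy) // mulr1.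
  by case: eqP => [->|_] /=; rewrite ?mulr1n ?mulr0n; ring.
rewrite (pairing_mull pairP _ _ _ usU Dx); auto.
transitivity (\sum_(p <- ts) \sum_(p' <- us)
    (pair (f j) p'.1 * (pair p.1 (e i) * pair p.2 p'.2))).
  rewrite big_seq [RHS]big_seq; apply: eq_bigr => p /tsU[Up1 Up2].
  rewrite mul1r (pairing_mull pairP _ _ _ usU Dx) // mulr_sumr.
  by apply: eq_bigr => p' _; ring.
rewrite exchange_big /= !mulr_sumr big_seq [RHS]big_seq.
apply: eq_bigr => p /usU[Up1 Up2]; rewrite -!mulr_sumr.
rewrite -(pairing_mulr pairP Uy _ _ tsU Dy) // IH //; ring.
Qed.
End SkewPairing.

(** * Skew derivatives on U^- *)

Section SkewDerivations.
Variables (K : fieldType) (rh sh : K) (n : nat).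
Local Notation U := (Urs rh sh n).
Local Notation e := (U_e rh sh).
Local Notation f := (U_f rh sh).
Local Notation w := (U_w rh sh).
Local Notation w' := (U_w' rh sh).
Local Notation wpair := (wpair rh sh).
Implicit Types (i j : 'I_n) (l : seq 'I_n) (lambda mu nu : 'rV[int]_n).
Variable Delta : {lrmorphism U -> tensor_alg U U}.
Hypothesis Delta_cop : is_coproduct Delta.
Variable pair : U -> U -> K.
Hypothesis pairP : is_pairing Delta pair.
Hypotheses (rh0 : rh != 0) (sh0 : sh != 0).
Local Notation c_ i := ((s_ sh i - r_ rh i)^-1).

Lemma U_minus0 mu : U_minus mu (0 : U).
Proof. exact: linear_span0. Qed.
Lemma U_minus_linear mu c (u v : U) :
  U_minus mu u -> U_minus mu v -> U_minus mu (c *: u + v).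
Proof. exact: linear_span_linear. Qed.
Lemma U_minusZ mu c (u : U) : U_minus mu u -> U_minus mu (c *: u).
Proof. exact: linear_spanZ. Qed.

(** Leibniz rule [E, G F] = [E, G] F + G [E, F] for E = e_i, G = f_j and F a word, followed by
    moving W' to the right end (scalar k) and W to the left end (scalar a). *)
Lemma skew_commutator_step (A : algType K) (E F G W W' p z : A) (c d k a : K) :
  E * F - F * E = c *: (z * W' - W * p) ->
  E * G = G * E + (c * d) *: (W' - W) ->
  W' * F = k *: (F * W') -> a *: (W * G) = G * W ->
  E * (G * F) - G * F * E =
  c *: ((G * z + (d * k) *: F) * W' - W * (d *: F + a *: (G * p))).
Proof.
move=> EF EG W'F WG; rewrite mulrA EG mulrDl -!mulrA addrAC -mulrBr EF.
rewrite -scalerAr mulrBr -scalerAl mulrBl W'F.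
rewrite mulrDl mulrDr -!scalerAl -!scalerAr (mulrA G W) -WG -scalerAl -!mulrA.
rewrite !(scalerBr, scalerDr, opprD, scalerA) mulrA.
by rewrite !mulrA addrACA; congr (_ + _); rewrite addrC.
Qed.

Lemma skew_commutator_linear (A : algType K) (E F1 F2 W W' p1 p2 z1 z2 : A) (c a : K) :
  E * F1 - F1 * E = c *: (z1 * W' - W * p1) ->
  E * F2 - F2 * E = c *: (z2 * W' - W * p2) ->
  E * (a *: F1 + F2) - (a *: F1 + F2) * E =
  c *: ((a *: z1 + z2) * W' - W * (a *: p1 + p2)).
Proof.
move=> F1E F2E.
rewrite !mulrDr !mulrDl opprD addrACA F2E -scalerAl -scalerAr -scalerBr F1E.
rewrite -scalerAl -scalerAr opprD addrACA -scalerBr [RHS]scalerDr.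
by rewrite !scalerA [c * a]mulrC.
Qed.

(** The value of k is irrelevant: the same k enters the commutator and the pairing formula for the
    right derivative. *)
Lemma U_w'_word i l : exists k, w' i * (\prod_(j <- l) f j) = k *: (\prod_(j <- l) f
  j * w' i).
Proof.
elim: l => [|j l [k IHl]]; first by exists 1; rewrite big_nil mulr1 mul1r scale1r.
rewrite !big_cons; set F := \prod_(_ <- _) _ in IHl *.
exists (rform rh (alpha i) (alpha j) / sform sh (alpha j) (alpha i) * k).
by rewrite mulrA U_w'f -scalerAl -[f j * w' i * F]mulrA IHl -scalerAr scalerA !mulrA.
Qed.

(* [p] and [z] are the left and right skew derivatives of [y].  Only their
   existence is needed, so their independence of the presentation of [y] as a
   combination of words does not have to be proved. *)
Definition skew_derivations i mu (y p z : U) : Prop :=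
  [/\ U_minus (mu - alpha i) p, U_minus (mu - alpha i) z,
      e i * y - y * e i = c_ i *: (z * w' i - w i * p),
      forall x, U_ge x -> pair y (e i * x) = c_ i * pair p x
    & forall x, U_ge x -> pair y (x * e i) = c_ i * pair (z * w' i) x].

Lemma skew_derivations_word i l :
  exists p z, skew_derivations i (\sum_(j <- l) alpha j) (\prod_(j <- l) f j) p z.
Proof.
elim: l => [|j l [p [z [Up Uz comm pe ep]]]].
  exists 0, 0; rewrite big_nil; split.
  - exact: U_minus0.
  - exact: U_minus0.
  - by rewrite mulr1 mul1r mul0r mulr0 !subrr scaler0.
  (* Since Delta 1 = 1 (x) 1, the value (1, e_i x) factors through (1, e_i) = 0. *)
  - move=> x Ux; have [ts tsU Dx] := U_ge_coproduct Delta_cop Ux.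
    rewrite (pairing_mulr pairP (ts := [:: (1, 1)])) //; auto.
    + by rewrite big_seq1 /= (pair_1e Delta_cop pairP rh0 sh0) mulr0 (pair0l pairP)
      ?mulr0.
    + exact: tens_in_cons.
    + by rewrite rmorph1 tens_sum1 tens11.
  - move=> x Ux; have [ts tsU Dx] := U_ge_coproduct Delta_cop Ux.
    rewrite (pairing_mulr pairP (ts := [:: (1, 1)])) //; auto.
    + by rewrite big_seq1 /= (pair_1e Delta_cop pairP rh0 sh0) mul0r mul0r (pair0l
      pairP) ?mulr0.
    + exact: tens_in_cons.
    + by rewrite rmorph1 tens_sum1 tens11.
rewrite !big_cons; have [k w'F] := U_w'_word i l.
have UF := U_minus_word rh sh l; set F := \prod_(_ <- _) _ in comm pe ep w'F UF *.
set mu := \sum_(_ <- _) _ in Up Uz UF *.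
(* The Kronecker delta protects the degree: F has degree alpha_j + mu - alpha_i only if j = i. *)
have Ud a : U_minus (alpha j + mu - alpha i) (((j == i)%:R * a) *: F).
  case: eqP => [->|_]; last by rewrite mul0r scale0r; apply: U_minus0.
  by rewrite addrC addKr mul1r; apply: U_minusZ.
have {}Ud1 := Ud 1; rewrite mulr1 in Ud1.
have UlF := U_minus_le UF; have Ulp := U_minus_le Up; have Ulz := U_minus_le Uz.
exists ((j == i)%:R *: F + wpair (alpha j) (alpha i) *: (f j * p)).
exists (f j * z + ((j == i)%:R * k) *: F); split.
- rewrite -[_ *: F]scale1r; apply: U_minus_linear => //; apply: U_minusZ.
  by rewrite -addrA; apply: U_minusM.
- rewrite -[f j * z]scale1r; apply: U_minus_linear => //.
  by rewrite -addrA; apply: U_minusM.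
- apply: (@skew_commutator_step (Urs rh sh n)) => //.
    apply/eqP; rewrite addrC -subr_eq; apply/eqP.
    rewrite U_ef -[w i - w' i]opprB scalerN -scaleNr; congr (_ *: _).
    by rewrite -mulrN -invrN opprB mulrC [j == i]eq_sym.
  (* Here the commutator and the pairing agree: the scalar (w'_j, w_i) produced by the pairing is
     the inverse of the one in w_i f_j = const f_j w_i. *)
  rewrite U_wf scalerA -[RHS]scale1r; congr (_ *: _).
  by rewrite /Defs.wpair mulrACA mulfV ?mulVf ?mulr1 // expfz_neq0.
- by move=> x Ux; apply: (pair_f_emul Delta_cop pairP).
- move=> x Ux; rewrite (pair_f_mule Delta_cop pairP j UlF _ ep) //; last by auto.
  by rewrite w'F scalerA mulrDl -scalerAl mulrA.
Qed.

Lemma skew_derivationsP i mu y : U_minus mu y ->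
  exists p z, skew_derivations i mu y p z.
Proof.
move=> Uy; elim: {y}Uy => [|c y1 y2 [l -> ->] Uy2 [p [z [Up Uz comm pe ep]]]].
  exists 0, 0; split.
  - exact: U_minus0.
  - exact: U_minus0.
  - by rewrite !mulr0 !mul0r !subrr scaler0.
  - by move=> x Ux; rewrite !(pair0l pairP) ?mulr0; auto.
  - by move=> x Ux; rewrite mul0r !(pair0l pairP) ?mulr0; auto.
have [p1 [z1 [Up1 Uz1 comm1 pe1 ep1]]] := skew_derivations_word i l.
set F := \prod_(_ <- _) _ in comm1 pe1 ep1 *.
have UF : U_le F by exact: U_le_word.
have {}Uy2 : U_le y2 by exact: U_minus_le Uy2.
have := U_minus_le Up; have := U_minus_le Uz.
have := U_minus_le Up1; have := U_minus_le Uz1.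
move=> *; exists (c *: p1 + p), (c *: z1 + z); split.
- exact: U_minus_linear.
- exact: U_minus_linear.
- exact: (@skew_commutator_linear (Urs rh sh n)).
- move=> x Ux; rewrite !(pairing_linearl pairP) ?pe1 ?pe //; auto; ring.
- move=> x Ux; rewrite mulrDl -scalerAl.
  rewrite !(pairing_linearl pairP) ?ep1 ?ep //; auto; ring.
Qed.

(** Against U^+ a right factor w'_j is invisible: Delta(z w'_j) multiplies both legs by w'_j, while
    (w'_j, 1) = 1 and (w'_j, e_i) = 0. This removes the w'_i from z w'_i, so that z itself can be
    expanded in a dual basis. *)
Lemma pair_w'_right j z l : U_le z ->
  pair (z * w' j) (\prod_(i <- l) e i) = pair z (\prod_(i <- l) e i).
Proof.
elim: l z => [|i l IHl] z Uz.
  rewrite big_nil (pairing_mull pairP (ts := [:: (1, 1)])) //; auto.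
  - by rewrite big_seq1 /= (pair_w'1 pairP) mulr1.
  - exact: tens_in_cons.
  - by rewrite rmorph1 tens_sum1 tens11.
rewrite big_cons; set x := \prod_(_ <- _) _.
have Ux : U_ge x by exact: U_ge_word.
have [us usU Dx] := U_ge_coproduct Delta_cop Ux.
have [ts tsU Dz] := U_le_coproduct Delta_cop Uz.
have tsU' : tens_in (@U_le K rh sh n)
    [seq (q.1 * w' j, q.2 * w' j) | q <- ts].
  by apply: (@tens_in_map _ _ _ _ _ ( *%R^~ (w' j)) ( *%R^~ (w' j))) => // u Uu;
    apply: U_leM.
have Dzw : Delta (z * w' j) = tens_sum [seq (q.1 * w' j, q.2 * w' j) | q <- ts].
  rewrite rmorphM /= (coproduct_w' Delta_cop) Dz.
  by rewrite /tens_sum mulr_suml big_map; apply: eq_bigr => q _; rewrite tensM.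
rewrite (pairing_mulr pairP _ _ _ tsU' Dzw) //; auto.
rewrite (pairing_mulr pairP _ _ _ tsU Dz) //.
rewrite big_map big_seq [RHS]big_seq; apply: eq_bigr => q /tsU[Uq1 Uq2] /=.
rewrite IHl //; congr (_ * _).
rewrite (pair_mul_e Delta_cop pairP) // (pair_w'1 pairP) mulr1.
by rewrite (pairing_w'e pairP) mulr0 addr0.
Qed.

End SkewDerivations.

(** * The operator Theta *)

Section DualBasesTensor.
Variables (K : fieldType) (rh sh : K) (n : nat).
Local Notation U := (Urs rh sh n).
Local Notation e := (U_e rh sh).
Local Notation w := (U_w rh sh).
Local Notation w' := (U_w' rh sh).
Implicit Types (i j : 'I_n) (l : seq 'I_n) (lambda mu nu : 'rV[int]_n).
Variable Delta : {lrmorphism U -> tensor_alg U U}.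
Hypothesis Delta_cop : is_coproduct Delta.
Variable pair : U -> U -> K.
Hypothesis pairP : is_pairing Delta pair.
Hypotheses (rh0 : rh != 0) (sh0 : sh != 0).
Local Notation c_ i := ((s_ sh i - r_ rh i)^-1).

Lemma U_plusMl j nu (x : U) : U_plus nu x -> U_plus (alpha j + nu) (e j * x).
Proof.
move=> Ux; elim: {x}Ux => [|c u v [l nuE ->] _ IH].
  by rewrite mulr0; apply: linear_span0.
rewrite mulrDr -scalerAr; apply: linear_spanP => //.
by exists (j :: l); rewrite big_cons // nuE.
Qed.
Lemma U_plusMr j nu (x : U) : U_plus nu x -> U_plus (nu + alpha j) (x * e j).
Proof.
move=> Ux; elim: {x}Ux => [|c u v [l nuE ->] _ IH].
  by rewrite mul0r; apply: linear_span0.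
rewrite mulrDl -scalerAl; apply: linear_spanP => //.
by exists (rcons l j); rewrite -cats1 big_cat big_seq1 // nuE.
Qed.

Lemma pair_w'_plus j nu z x : U_le z -> U_plus nu x -> pair (z * w' j) x = pair z x.
Proof.
move=> Uz Ux; have := Ux; move=> Ux'; elim: {x Ux}Ux' => [|c u v [l _ ->] Uv IH].
  by rewrite !(pair0r pairP); auto.
have Uge := U_ge_word rh sh l; have {}Uv := U_plus_ge Uv.
by rewrite !(pairing_linearr pairP) ?IH ?(pair_w'_right Delta_cop pairP); auto.
Qed.

Section DualBases.
Variables (mu : 'rV[int]_n) (d : nat) (x y : 'I_d -> U).
Hypothesis xyP : is_dual_bases pair mu x y.

Lemma dual_bases_ge k : U_ge (x k).
Proof. by have [Ux _ _] := dual_bases_plus xyP; apply: U_plus_ge (Ux k). Qed.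
Lemma dual_bases_le k : U_le (y k).
Proof. by have [Uy _ _] := dual_bases_minus xyP; apply: U_minus_le (Uy k). Qed.

Lemma dual_bases_minus_expand z : U_minus mu z -> z = \sum_k pair z (x k) *: y k.
Proof.
have [_ _ gen] := dual_bases_minus xyP => /gen[c ->].
apply: eq_bigr => k _; rewrite (pair_suml pairP);
  [|exact: dual_bases_le|exact: dual_bases_ge].
rewrite (bigD1 k) //= (dual_bases_pair xyP) eqxx mulr1 big1 ?addr0 // => l /negPf lk.
by rewrite (dual_bases_pair xyP) lk mulr0.
Qed.

Lemma dual_bases_plus_expand z : U_plus mu z -> z = \sum_k pair (y k) z *: x k.
Proof.
have [_ _ gen] := dual_bases_plus xyP => /gen[c ->].
apply: eq_bigr => k _; rewrite (pair_sumr pairP);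
  [|exact: dual_bases_le|exact: dual_bases_ge].
rewrite (bigD1 k) //= (dual_bases_pair xyP) eqxx mulr1 big1 ?addr0 // => l /negPf lk.
by rewrite (dual_bases_pair xyP) eq_sym lk mulr0.
Qed.
End DualBases.

Variables (m : nat) (rho : {lrmorphism U -> 'M[K]_m}).
Definition rho2 (u v : U) : 'M[K]_(m * m) := rho u *t rho v.

Lemma rho2_linearl c u v a : rho2 (c *: u + v) a = c *: rho2 u a + rho2 v a.
Proof. by apply/matrixP => p q; rewrite /rho2 linearP !mxE mulrDl mulrA. Qed.
Lemma rho2_linearr c u v a : rho2 a (c *: u + v) = c *: rho2 a u + rho2 a v.
Proof. by apply/matrixP => p q; rewrite /rho2 linearP !mxE mulrDr mulrCA. Qed.
Lemma rho20l a : rho2 0 a = 0.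
Proof. by rewrite /rho2 linear0 tens0mx. Qed.
Lemma rho20r a : rho2 a 0 = 0.
Proof. by rewrite /rho2 linear0 tensmx0. Qed.
Lemma rho2_suml d c (u : 'I_d -> U) a :
  rho2 (\sum_k c k *: u k) a = \sum_k c k *: rho2 (u k) a.
Proof.
elim/big_rec2: _ => [|k A B _ <-]; first exact: rho20l.
by rewrite rho2_linearl.
Qed.
Lemma rho2_sumr d c (u : 'I_d -> U) a :
  rho2 a (\sum_k c k *: u k) = \sum_k c k *: rho2 a (u k).
Proof.
elim/big_rec2: _ => [|k A B _ <-]; first exact: rho20r.
by rewrite rho2_linearr.
Qed.
Lemma rho2M u v u' v' : rho2 u v *m rho2 u' v' = rho2 (u * u') (v * v').
Proof. by rewrite /rho2 tensmx_mul !rmorphM. Qed.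
Lemma rho2Zl c u a : rho2 (c *: u) a = c *: rho2 u a.
Proof. by rewrite -[c *: u]addr0 rho2_linearl rho20l addr0. Qed.

Lemma rho2Bl u v a : rho2 (u - v) a = rho2 u a - rho2 v a.
Proof. by apply/matrixP => p q; rewrite /rho2 linearB !mxE mulrBl. Qed.

Definition dual_tensor d (x y : 'I_d -> U) := \sum_k rho2 (y k) (x k).

(** By adjunction c_i p_k is the sum over l of (y_k, e_i x'_l) y'_l. After exchanging sums, the
    coefficients (y_k, e_i x'_l) reassemble e_i x'_l from its coordinates in the x_k. The right
    derivatives z_k give x'_l e_i in the same way. *)
Lemma dual_tensor_commutator i mu d d' (x y : 'I_d -> U) (x' y' : 'I_d' -> U) :
  is_dual_bases pair mu x y -> is_dual_bases pair (mu - alpha i) x' y' ->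
  rho2 (e i) 1 *m dual_tensor x y - dual_tensor x y *m rho2 (e i) 1 =
  dual_tensor x' y' *m rho2 (w' i) (e i) - rho2 (w i) (e i) *m dual_tensor x' y'.
Proof.
move=> xyP xyP'.
have [[Ux _ _] [Uy _ _]] := (dual_bases_plus xyP, dual_bases_minus xyP).
have [[Ux' _ _] [Uy' _ _]] := (dual_bases_plus xyP', dual_bases_minus xyP').
have Ulx' := dual_bases_ge xyP'.
have /fin_all_exists[p /fin_all_exists[z pzP]] :=
  fun k => skew_derivationsP Delta_cop pairP rh0 sh0 i (Uy k).
have pE : \sum_k c_ i *: rho2 (p k) (x k) = \sum_k rho2 (y' k) (e i * x' k).
  transitivity (\sum_k \sum_l pair (y k) (e i * x' l) *: rho2 (y' l) (x k)).
    apply: eq_bigr => k _; have [Up _ _ pe _] := pzP k.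
    rewrite {1}(dual_bases_minus_expand xyP' Up) rho2_suml scaler_sumr.
    by apply: eq_bigr => l _; rewrite scalerA pe.
  rewrite exchange_big; apply: eq_bigr => l _ /=; rewrite -rho2_sumr.
  congr (rho2 _ _); apply/esym/(dual_bases_plus_expand xyP).
  by rewrite -[mu](subrK (alpha i)) addrC; apply: U_plusMl.
have zE : \sum_k c_ i *: rho2 (z k) (x k) = \sum_k rho2 (y' k) (x' k * e i).
  transitivity (\sum_k \sum_l pair (y k) (x' l * e i) *: rho2 (y' l) (x k)).
    apply: eq_bigr => k _; have [_ Uz _ _ ep] := pzP k.
    rewrite {1}(dual_bases_minus_expand xyP' Uz) rho2_suml scaler_sumr.
    apply: eq_bigr => l _; rewrite scalerA ep //.
    by rewrite (pair_w'_plus i (U_minus_le Uz) (Ux' l)).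
  rewrite exchange_big; apply: eq_bigr => l _ /=; rewrite -rho2_sumr.
  congr (rho2 _ _); apply/esym/(dual_bases_plus_expand xyP).
  by rewrite -[mu](subrK (alpha i)); apply: U_plusMr.
rewrite /dual_tensor !mulmx_sumr !mulmx_suml.
transitivity (\sum_k (c_ i *: rho2 (z k) (x k) *m rho2 (w' i) 1
                      - rho2 (w i) 1 *m (c_ i *: rho2 (p k) (x k)))).
  rewrite -sumrB; apply: eq_bigr => k _; have [_ _ comm _ _] := pzP k.
  rewrite -scalemxAl -scalemxAr !rho2M !mul1r !mulr1.
  by rewrite -scalerBr -!rho2Bl comm rho2Zl.
rewrite sumrB; congr (_ - _).
  rewrite -[LHS]mulmx_suml zE mulmx_suml.
  by apply: eq_bigr => k _; rewrite !rho2M mulr1.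
rewrite -[LHS]mulmx_sumr pE mulmx_sumr.
by apply: eq_bigr => k _; rewrite !rho2M mul1r.
Qed.
End DualBasesTensor.

(** * Degrees of words in the simple roots *)

Section Weights.
Variable n : nat.
Implicit Types (i j : 'I_n) (l : seq 'I_n) (lambda mu nu : 'rV[int]_n).

(** An additive function that is positive on every simple root; it serves to show that a nonempty
    sum of simple roots is nonzero. *)
Definition height lambda : int := \sum_(j < n) (n - j)%:Z * lambda 0 j.

Lemma heightD lambda mu : height (lambda + mu) = height lambda + height mu.
Proof. by rewrite /height -big_split; apply: eq_bigr => j _; rewrite mxE mulrDr. Qed.

Lemma heightN lambda : height (- lambda) = - height lambda.
Proof. by rewrite /height -sumrN; apply: eq_bigr => j _; rewrite mxE mulrN. Qed.

Lemma height_eps k : (k < n)%N -> height (eps k) = (n - k)%:Z.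
Proof.
move=> kn; rewrite /height (bigD1 (Ordinal kn)) //= mxE eqxx mulr1 big1 ?addr0 //.
by move=> j; rewrite -val_eqE mxE /= => /negPf->; rewrite mulr0.
Qed.

Lemma height_alpha i : 0 < height (alpha i).
Proof.
rewrite /alpha; case: ifP => [iN|_].
  by rewrite heightD heightN !height_eps //; lia.
by rewrite mulr2n heightD height_eps //; have := ltn_ord i; lia.
Qed.

Lemma height_word l : ((size l)%:Z <= height (\sum_(i <- l) alpha i)).
Proof.
elim: l => [|i l IHl].
  by rewrite big_nil /height big1 // => j _; rewrite mxE mulr0.
rewrite big_cons heightD [size _]/= -add1n PoszD Num.Theory.lerD //.
exact: height_alpha.
Qed.

Lemma word_weight_eq0 l : \sum_(i <- l) alpha i = 0 -> l = [::].
Proof.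
move=> l0; have := height_word l; rewrite l0 /height big1 ?lez_nat ?leqn0 ?size_eq0.
  by move/eqP.
by move=> j _; rewrite mxE mulr0.
Qed.

Lemma word_weight_root_comb l :
  \sum_(i <- l) alpha i = root_comb (fun i => (count_mem i l)%:Z).
Proof.
elim: l => [|j l IHl]; first by rewrite big_nil /root_comb big1.
rewrite big_cons IHl /root_comb [RHS](eq_bigr (fun i =>
  (if i == j then alpha j else 0) + alpha i *~ (count_mem i l)%:Z)); last first.
  by move=> i _; rewrite /= PoszD mulrzDr eq_sym; case: eqP => [->|].
by rewrite big_split /= -big_mkcond big_pred1_eq.
Qed.

Lemma positive_weight_word l : \sum_(i <- l) alpha i != 0 ->
  positive_weight (\sum_(i <- l) alpha i).
Proof. by split=> //; exists (fun i => count_mem i l);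
  apply: word_weight_root_comb. Qed.

Lemma positive_weight_neq0 mu : positive_weight mu -> mu != 0.
Proof. by case. Qed.
End Weights.

Section LowerTriangular.
Variables (K : fieldType) (rh sh : K) (n : nat).
Local Notation U := (Urs rh sh n).
Local Notation f := (U_f rh sh).
Implicit Types (i j : 'I_n) (l : seq 'I_n) (lambda mu nu : 'rV[int]_n).
Local Notation N := (2 * n)%N.
Variable rho : {lrmorphism U -> 'M[K]_N}.
Hypothesis rhoP : is_first_fundamental rho.

Lemma V_f_lower i (k l : 'I_N) : (k <= l)%N -> V_f rh sh i k l = 0.
Proof.
move=> kl; have iN := ltn_ord i; rewrite /V_f; case: ifP => [iN'|_]; rewrite !mxE.
  have -> : (k == i.+1 :> nat) && (l == i :> nat) = false by lia.
  have -> : (k == op n i :> nat) && (l == op n i.+1 :> nat) = false by rewrite /op; lia.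
  by rewrite mulr0 subrr.
have -> : (k == op n i :> nat) && (l == i :> nat) = false by rewrite /op; lia.
by rewrite mulr0.
Qed.

(** Each f_i sends a basis vector to a multiple of one of larger index, so a word raises the index
    by at least its length. *)
Lemma rho_word_lower l (a b : 'I_N) : (a < b + size l)%N ->
  rho (\prod_(i <- l) f i) a b = 0.
Proof.
elim: l a b => [|i l IHl] a b ab.
  by rewrite big_nil rmorph1 mxE -val_eqE /=; case: eqP ab => // ->; rewrite addn0 ltnn.
rewrite big_cons rmorphM /= (fundamental_f rhoP) mxE big1 // => k _.
case: (leqP a k) => [ak|ka]; first by rewrite V_f_lower ?mul0r.
by rewrite IHl ?mulr0 //; move: ab => /=; lia.
Qed.

Lemma rho_minus_lower mu y (a b : 'I_N) : U_minus mu y -> mu != 0 -> (a <= b)%N ->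
  rho y a b = 0.
Proof.
move=> Uy mu0 ab; elim: {y}Uy => [|c u v [l muE ->] _ IH]; first by rewrite linear0 mxE.
rewrite linearP !mxE IH rho_word_lower ?mulr0 ?addr0 //.
case: l muE => [|i l] muE /=; last by lia.
by rewrite muE big_nil eqxx in mu0.
Qed.

(** A finite list of degrees outside which U^- acts on V by 0: any word of another degree has length
    above 2n. *)
Definition weights : seq 'rV[int]_n :=
  undup [seq \sum_(i <- val b) alpha i | b <- enum {: N.-bseq 'I_n}].

Lemma rho_minus_eq0 mu y : U_minus mu y -> mu \notin weights -> rho y = 0.
Proof.
move=> Uy; rewrite mem_undup => muN.
elim: {y}Uy => [|c u v [l muE ->] _ IH]; first by rewrite linear0.
rewrite linearP /= IH addr0; apply/matrixP => a b; rewrite !mxE.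
rewrite rho_word_lower ?mulr0 //.
case: (leqP (size l) N) => [lN|]; last by have := ltn_ord a; lia.
case/negP: muN; apply/mapP; exists (Bseq lN); rewrite ?mem_enum //.
Qed.

End LowerTriangular.

Section ThetaComponents.
Variables (K : fieldType) (rh sh : K) (n : nat).
Local Notation U := (Urs rh sh n).
Local Notation e := (U_e rh sh).
Local Notation w := (U_w rh sh).
Local Notation w' := (U_w' rh sh).
Implicit Types (i j : 'I_n) (l : seq 'I_n) (lambda mu nu : 'rV[int]_n).
Variable Delta : {lrmorphism U -> tensor_alg U U}.
Hypothesis Delta_cop : is_coproduct Delta.
Variable pair : U -> U -> K.
Hypothesis pairP : is_pairing Delta pair.
Hypotheses (rh0 : rh != 0) (sh0 : sh != 0).

Local Notation N := (2 * n)%N.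
Variable rho : {lrmorphism U -> 'M[K]_N}.
Hypothesis rhoP : is_first_fundamental rho.
Local Notation weights := (@weights n).

Variables (dim : 'rV[int]_n -> nat) (x y : forall mu, 'I_(dim mu) -> U).
Hypothesis xyP : forall mu, positive_weight mu -> is_dual_bases pair mu (@x mu) (@y mu).

(* Defined for all [mu], so that [Theta_comp_commutator] needs no side
   condition and Theta becomes a sum over the whole weight lattice. *)
Definition Theta_comp mu : 'M[K]_(N * N) :=
  if mu == 0 then 1%:M
  else if `[< positive_weight mu >] then dual_tensor rho (@x mu) (@y mu) else 0.

(** Only the empty word has degree 0, so both components are K 1; independence of the family 1 is
    the nontriviality of U. *)
Lemma dual_bases_zero : is_dual_bases pair 0 (fun _ : 'I_1 => 1) (fun _ : 'I_1 => 1).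
Proof.
have basis (W : U -> Prop) : W 1 -> (forall u, W u -> exists c : K, u = c *: 1) ->
    is_basis W (fun _ : 'I_1 => 1).
  move=> W1 Wu; split=> [_|c|u /Wu[c ->]] //.
    rewrite big_ord1 => /eqP; rewrite scaler_eq0 (negPf (Urs_oner_neq0 _ _ _)) orbF.
    by move/eqP=> c0 i; rewrite (ord1 i).
  by exists (fun=> c); rewrite big_ord1.
have scal (g : 'I_n -> U) u : linear_span (fun u =>
    exists2 l, 0 = \sum_(i <- l) alpha i & u = \prod_(i <- l) g i) u ->
    exists c : K, u = c *: 1.
  elim=> [|c _ b [l /esym/word_weight_eq0-> ->] _ [d ->]].
    by exists 0; rewrite scale0r.
  by exists (c + d); rewrite big_nil scalerDl.
split.
- apply: basis; last exact: scal.
  by apply: linear_span_gen; exists [::]; rewrite big_nil.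
- apply: basis; last exact: scal.
  by apply: linear_span_gen; exists [::]; rewrite big_nil.
- by move=> i j; rewrite (ord1 i) (ord1 j) (pair11 pairP).
Qed.

(** No word has such a degree, so both components vanish and empty families are dual bases. *)
Lemma dual_bases_empty mu (x0 y0 : 'I_0 -> U) : mu != 0 -> ~ positive_weight mu ->
  is_dual_bases pair mu x0 y0.
Proof.
move=> mu0 muN.
have zero (g : 'I_n -> U) u : linear_span (fun u =>
    exists2 l, mu = \sum_(i <- l) alpha i & u = \prod_(i <- l) g i) u -> u = 0.
  elim=> // c a b [l muE _]; case: muN.
  by rewrite muE; apply: positive_weight_word; rewrite -muE.
split; last by case.
  by split=> [[] //|c _ [] //|u /zero->]; exists (fun=> 0); rewrite big_ord0.
by split=> [[] //|c _ [] //|u /zero->]; exists (fun=> 0); rewrite big_ord0.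
Qed.

Lemma Theta_comp_dual mu : exists d (x' y' : 'I_d -> U),
  is_dual_bases pair mu x' y' /\ Theta_comp mu = dual_tensor rho x' y'.
Proof.
rewrite /Theta_comp; have [->|mu0] := eqVneq mu 0.
  exists 1%N, (fun=> 1), (fun=> 1); split; first exact: dual_bases_zero.
  rewrite /dual_tensor big_ord1 /rho2 !rmorph1; apply/matrixP => a b.
  case: (mxtens_indexP a) => a1 a2; case: (mxtens_indexP b) => b1 b2.
  rewrite tensmxE !mxE -natrM mulnb -xpair_eqE.
  by rewrite (can_eq (@mxtens_indexK _ _) (a1, a2) (b1, b2)).
case: asboolP => [mup|muN].
  by exists (dim mu), (@x mu), (@y mu); split=> //; apply: xyP.
exists 0%N, (fun=> 0), (fun=> 0); split; first exact: dual_bases_empty.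
by rewrite /dual_tensor big_ord0.
Qed.

Lemma Theta_comp_eq0 mu : mu \notin 0 :: weights -> Theta_comp mu = 0.
Proof.
rewrite inE negb_or /Theta_comp => /andP[/negPf-> muW].
case: asboolP => // mup; rewrite /dual_tensor big1 // => k _.
have [Uy _ _] := dual_bases_minus (xyP mup).
by rewrite /rho2 (rho_minus_eq0 rhoP (Uy k)) // tens0mx.
Qed.

(** The freedom in [r] is what allows the sum to be reindexed by a translation of the weights. *)
Lemma Theta_VV_sum (r : seq 'rV[int]_n) : uniq r -> {subset 0 :: weights <= r} ->
  Theta_VV rho x y = \sum_(mu <- r) Theta_comp mu.
Proof.
move=> r_uniq rW; rewrite (bigD1_seq 0) ?rW ?mem_head //= {1}/Theta_comp eqxx.
congr (_ + _).
rewrite (eq_fsbigr Theta_comp); last first.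
  move=> mu; rewrite inE /= => mup; rewrite /Theta_comp.
  by rewrite (negPf (positive_weight_neq0 mup)) asboolT.
have Theta0 mu : mu != 0 -> ~ positive_weight mu -> Theta_comp mu = 0.
  by move=> mu0 muN; rewrite /Theta_comp (negPf mu0); case: asboolP.
rewrite (fsbigE [seq mu <- r | `[< positive_weight mu >]]).
- rewrite big_filter_cond big_mkcond [RHS]big_mkcond; apply: eq_bigr => mu _.
  case: asboolP => [mup|muN] /=.
    by rewrite (positive_weight_neq0 mup) ifT //; apply: mem_set.
  by case: ifP => // mu0; rewrite Theta0.
- exact: filter_uniq.
- by move=> mu /=; rewrite mem_filter => /andP[/asboolP].
- move=> mu /= mup; rewrite mem_filter asboolT //= => muN.
  by apply: Theta_comp_eq0; apply: contra muN => /rW.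
Qed.

Lemma Theta_comp_commutator i mu :
  rho2 rho (e i) 1 *m Theta_comp mu - Theta_comp mu *m rho2 rho (e i) 1 =
  Theta_comp (mu - alpha i) *m rho2 rho (w' i) (e i)
    - rho2 rho (w i) (e i) *m Theta_comp (mu - alpha i).
Proof.
have [d [x1 [y1 [xy1 ->]]]] := Theta_comp_dual mu.
have [d' [x2 [y2 [xy2 ->]]]] := Theta_comp_dual (mu - alpha i).
exact: (dual_tensor_commutator Delta_cop pairP rh0 sh0 rho xy1 xy2).
Qed.

Lemma Theta_intertwines i :
  (rho2 rho (e i) 1 + rho2 rho (w i) (e i)) *m Theta_VV rho x y =
  Theta_VV rho x y *m (rho2 rho (e i) 1 + rho2 rho (w' i) (e i)).
Proof.
pose r0 := 0 :: weights.
(* [r] contains the support of [Theta_comp] together with its translate by alpha_i. Hence mu and mu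
   - alpha_i, for mu in [r], both run over the whole support. *)
pose r := undup (r0 ++ [seq mu + alpha i | mu <- r0]).
have r_uniq : uniq r by exact: undup_uniq.
have ThE : Theta_VV rho x y = \sum_(mu <- r) Theta_comp mu.
  by apply: Theta_VV_sum => // mu mur; rewrite mem_undup mem_cat mur.
have ThE' : Theta_VV rho x y = \sum_(mu <- r) Theta_comp (mu - alpha i).
  rewrite (@Theta_VV_sum [seq mu - alpha i | mu <- r]) ?big_map //.
    by rewrite map_inj_uniq //; apply: addIr.
  move=> mu mur; apply/mapP; exists (mu + alpha i); last by rewrite addrK.
  by rewrite mem_undup mem_cat orbC (map_f (fun nu => nu + alpha i) mur).
move: (Theta_VV _ _ _) ThE ThE' => Th ThE ThE'.
apply/eqP; rewrite mulmxDl mulmxDr -subr_eq0 opprD addrACA {1 2}ThE ThE'.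
rewrite !mulmx_suml !mulmx_sumr -!sumrB -big_split big1 //= => mu _.
by rewrite Theta_comp_commutator addrC addrA subrK subrr.
Qed.
End ThetaComponents.

(** * The explicit operator Rhat *)

Section BasisVectors.
Variables (K : fieldType) (n : nat).
Local Notation N := (2 * n)%N.
Local Notation E := (@E K n).

Definition bvec (k : nat) : 'cV[K]_N := \col_i (i == k :> nat)%:R.
Definition bcov (k : nat) : 'rV[K]_N := \row_i (i == k :> nat)%:R.
Definition bvec2 k l : 'M[K]_(N * N, 1 * 1) := bvec k *t bvec l.
Definition bcov2 k l : 'M[K]_(1 * 1, N * N) := bcov k *t bcov l.

Lemma bvec_ord (k : 'I_N) : bvec k = delta_mx k 0.
Proof. by apply/matrixP => i j; rewrite !mxE (ord1 j) eqxx andbT. Qed.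
Lemma bcov_ord (k : 'I_N) : bcov k = delta_mx 0 k.
Proof. by apply/matrixP => i j; rewrite !mxE (ord1 i) eqxx. Qed.

Lemma sum_delta (V : lmodType K) m (k : nat) (F : nat -> V) : (k < m)%N ->
  \sum_(i < m) (i == k :> nat)%:R *: F i = F k.
Proof.
move=> kN; rewrite (bigD1 (Ordinal kN)) //= eqxx scale1r big1 ?addr0 // => i.
by rewrite -val_eqE /= => /negPf->; rewrite scale0r.
Qed.

Lemma mul_E_bvec i j k : (k < N)%N -> E i j *m bvec k = (j == k)%:R *: bvec i.
Proof.
move=> kN; have -> : bvec k = delta_mx (Ordinal kN) 0 by rewrite -bvec_ord.
by rewrite -colE; apply/matrixP => a b; rewrite !mxE andbC eq_sym -natrM mulnb /=.
Qed.

Lemma mul_bcov_E i j k : (k < N)%N -> bcov k *m E i j = (k == i)%:R *: bcov j.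
Proof.
move=> kN; have -> : bcov k = delta_mx 0 (Ordinal kN) by rewrite -bcov_ord.
by rewrite -rowE; apply/matrixP => a b; rewrite !mxE -natrM mulnb /=.
Qed.

Lemma tens_scale (c d : K) m1 n1 m2 n2 (A : 'M[K]_(m1, n1)) (B : 'M[K]_(m2, n2)) :
  (c *: A) *t (d *: B) = (c * d) *: (A *t B).
Proof. by apply/matrixP => i j; rewrite !mxE; ring. Qed.

Lemma mul_E2_bvec2 a b c d k l : (k < N)%N -> (l < N)%N ->
  (E a b *t E c d) *m bvec2 k l = ((b == k) && (d == l))%:R *: bvec2 a c.
Proof.
move=> kN lN; rewrite tensmx_mul !mul_E_bvec // tens_scale.
by rewrite -natrM mulnb.
Qed.

Lemma matrix_bvecP m (A B : 'M[K]_(m, N)) :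
  (forall k, (k < N)%N -> A *m bvec k = B *m bvec k) -> A = B.
Proof.
move=> AB; apply/matrixP => a b; have := AB b (ltn_ord b).
by rewrite bvec_ord -!colE => /matrixP/(_ a 0); rewrite !mxE.
Qed.

Lemma matrix_bvec2P m (A B : 'M[K]_(m, N * N)) :
  (forall k l, (k < N)%N -> (l < N)%N -> A *m bvec2 k l = B *m bvec2 k l) -> A = B.
Proof.
move=> AB; apply/matrixP => a b; case: (mxtens_indexP b) => k l.
have := AB k l (ltn_ord k) (ltn_ord l); rewrite /bvec2 !bvec_ord.
have -> : delta_mx k (0 : 'I_1) *t delta_mx l (0 : 'I_1)
    = delta_mx (mxtens_index (k, l)) 0 :> 'M[K]_(N * N, 1 * 1).
  apply/matrixP => i j; case: (mxtens_indexP i) => i1 i2.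
  rewrite (ord1 j) mxE mxtens_indexK !mxE !(ord1 (mxtens_unindex _).1).
  rewrite !(ord1 (mxtens_unindex _).2) !andbT.
  rewrite (can_eq (@mxtens_indexK _ _) (i1, i2) (k, l)) xpair_eqE.
  by rewrite -natrM mulnb.
by rewrite -!colE => /matrixP/(_ a 0); rewrite !mxE.
Qed.

Lemma matrix_bcov2P m (A B : 'M[K]_(N * N, m)) :
  (forall k l, (k < N)%N -> (l < N)%N -> bcov2 k l *m A = bcov2 k l *m B) -> A = B.
Proof.
move=> AB; apply/matrixP => b a; case: (mxtens_indexP b) => k l.
have := AB k l (ltn_ord k) (ltn_ord l); rewrite /bcov2 !bcov_ord.
have -> : delta_mx (0 : 'I_1) k *t delta_mx (0 : 'I_1) l
    = delta_mx 0 (mxtens_index (k, l)) :> 'M[K]_(1 * 1, N * N).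
  apply/matrixP => j i; case: (mxtens_indexP i) => i1 i2.
  rewrite (ord1 j) mxE mxtens_indexK !mxE !(ord1 (mxtens_unindex _).1).
  rewrite !(ord1 (mxtens_unindex _).2) /=.
  rewrite (can_eq (@mxtens_indexK _ _) (i1, i2) (k, l)) xpair_eqE.
  by rewrite -natrM mulnb.
by rewrite -!rowE => /matrixP/(_ 0 a); rewrite !mxE.
Qed.

(** The indices are crossed because the lemma is shaped for sums of E_ij (x) E_ji, which exchange
    the two factors; diagonal sums use it with k and l swapped. *)
Lemma sum2_delta (V : lmodType K) k l (P : nat -> nat -> bool) (F : nat -> nat -> V) :
  (k < N)%N -> (l < N)%N ->
  \sum_(i < N) \sum_(j < N | P i j) ((j == k :> nat) && (i == l :> nat))%:R *: F i j =
  (P l k)%:R *: F l k.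
Proof.
move=> kN lN; rewrite -(sum_delta (fun i => (P i k)%:R *: F i k) lN).
apply: eq_bigr => i _; rewrite big_mkcond /=.
rewrite -(sum_delta (fun j => (i == l :> nat)%:R *: ((P i j)%:R *: F i j)) kN).
apply: eq_bigr => j _; case: (P i j); last by rewrite scale0r !scaler0.
by rewrite !scalerA mulr1 -natrM mulnb.
Qed.
End BasisVectors.

(** * Pairings between the weights of V *)

Section VectorWeights.
Variables (K : fieldType) (rh sh : K) (n : nat).
Local Notation N := (2 * n)%N.
Local Notation wpair := (wpair rh sh).
Local Notation wt := (V_weight n).
Implicit Types (i : 'I_n) (lambda mu nu : 'rV[int]_n).

Lemma form2Dl lambda mu nu : form2 (lambda + mu) nu = form2 lambda nu + form2 mu nu.
Proof.
rewrite /form2 -big_split; apply: eq_bigr => i _; rewrite -big_split.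
by apply: eq_bigr => j _; rewrite mxE /=; ring.
Qed.
Lemma form2Dr lambda mu nu : form2 nu (lambda + mu) = form2 nu lambda + form2 nu mu.
Proof.
rewrite /form2 -big_split; apply: eq_bigr => i _; rewrite -big_split.
by apply: eq_bigr => j _; rewrite mxE /=; ring.
Qed.
Lemma form2Nl lambda nu : form2 (- lambda) nu = - form2 lambda nu.
Proof.
rewrite /form2 -sumrN; apply: eq_bigr => i _; rewrite -sumrN.
by apply: eq_bigr => j _; rewrite mxE /=; ring.
Qed.
Lemma form2Nr lambda nu : form2 nu (- lambda) = - form2 nu lambda.
Proof.
rewrite /form2 -sumrN; apply: eq_bigr => i _; rewrite -sumrN.
by apply: eq_bigr => j _; rewrite mxE /=; ring.
Qed.

Lemma wpairNl lambda nu : wpair (- lambda) nu = (wpair lambda nu)^-1.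
Proof. by rewrite /Defs.wpair /rform /sform form2Nl form2Nr -!invr_expz invfM. Qed.
Lemma wpairNr lambda nu : wpair nu (- lambda) = (wpair nu lambda)^-1.
Proof. by rewrite /Defs.wpair /rform /sform form2Nl form2Nr -!invr_expz invfM. Qed.

Lemma form2_eps a b : (a < n)%N -> (b < n)%N ->
  form2 (eps a : 'rV_n) (eps b) = if (b <= a)%N then 1 else -1.
Proof.
move=> an bn; rewrite /form2 (bigD1 (Ordinal an)) //= [X in _ + X]big1 => [|i].
  rewrite addr0 (bigD1 (Ordinal bn)) //= [X in _ + X]big1 => [|j].
    by rewrite addr0 !mxE !eqxx !mulr1.
  by rewrite -val_eqE !mxE /= => /negPf->; rewrite !mulr0.
by rewrite -val_eqE /= => /negPf ai; apply: big1 => j _; rewrite !mxE ai mul0r mulr0.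
Qed.

(** The weight of v_k is [sigma n k] times eps of [vabs k], so every pairing of weights reduces to a
    power of [eps_pair]. *)
Definition vabs (k : nat) : nat := if (k < n)%N then k else op n k.

Lemma vabs_lt k : (k < N)%N -> (vabs k < n)%N.
Proof. by rewrite /vabs /op; case: ifP; lia. Qed.

Definition eps_pair (a b : nat) : K :=
  if a == b then rh / sh else if (b < a)%N then rh * sh else (rh * sh)^-1.

Lemma wpair_eps a b : (a < n)%N -> (b < n)%N -> wpair (eps a : 'rV_n) (eps b) =
  eps_pair a b.
Proof.
move=> an bn; rewrite /Defs.wpair /rform /sform !form2_eps // /eps_pair.
case: (ltngtP a b) => ab; rewrite ?expr1z ?exprN1 ?invrK //.
by rewrite invfM.
Qed.

Lemma wpair_wt k l : (k < N)%N -> (l < N)%N ->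
  wpair (wt k) (wt l) = eps_pair (vabs k) (vabs l) ^ (sigma n k * sigma n l).
Proof.
move=> kN lN; have := vabs_lt kN; have := vabs_lt lN.
rewrite /V_weight /vabs /sigma; case: ifP => _; case: ifP => _ an bn;
  rewrite ?wpairNl ?wpairNr wpair_eps // ?invrK ?mulr1 ?mul1r ?mulrN1 ?opprK //.
Qed.

Lemma wt_op k : (k < N)%N -> wt (op n k) = - wt k.
Proof.
move=> kN; rewrite /V_weight; case: ifP => h1; case: ifP => h2; rewrite ?opprK //.
- by move: h1 h2; rewrite /op; lia.
- by congr (- eps _); move: h1 h2; rewrite /op; lia.
- by move: h1 h2; rewrite /op; lia.
Qed.

Lemma wpair_wt_diag k : (k < N)%N -> wpair (wt k) (wt k) = rh / sh.
Proof.
by move=> kN; rewrite wpair_wt // /eps_pair eqxx /sigma; case: ifP.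
Qed.

(** For distinct a and b the form is antisymmetric on eps_a, eps_b, so exchanging the arguments
    inverts the pairing; the excluded l are those whose weight is plus or minus that of v_k. *)
Lemma wpair_wt_sym k l : (k < N)%N -> (l < N)%N -> l != k -> l != op n k ->
  wpair (wt l) (wt k) = (wpair (wt k) (wt l))^-1.
Proof.
move=> kN lN lk lk'; rewrite !wpair_wt // /eps_pair.
have : vabs k != vabs l.
  by move: lk lk'; rewrite /vabs /op; case: ifP; case: ifP; lia.
rewrite [vabs l == _]eq_sym [sigma n l * _]mulrC => /negPf kl; rewrite kl.
have [_|_|/eqP] := ltngtP (vabs k) (vabs l); last by rewrite kl.
  by rewrite exprz_inv invr_expz opprK.
by rewrite exprz_inv invr_expz.
Qed.

Lemma wpair_wt_a k l : (k < N)%N -> (l < N)%N -> l != k -> l != op n k ->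
  (wpair (wt k) (wt l))^-1 = a_ rh sh n l k.
Proof.
move=> kN lN lk lk'; rewrite wpair_wt // /eps_pair /a_ [sigma n k * _]mulrC.
have -> : vabs k == vabs l = false.
  by move: lk lk'; rewrite /vabs /op; case: ifP; case: ifP; lia.
(* The case distinction in the definition of a_ij only records which of the two underlying eps comes
   first; the signs are carried by sigma. *)
have -> : ((l < k) && (l < op n k) || (k < l) && (op n k < l))%N = (vabs l < vabs k)%N.
  by move: lk lk'; rewrite /vabs /op; case: ifP; case: ifP; lia.
by case: ifP => _; rewrite invr_expz // exprz_inv opprK.
Qed.

(** The coefficient in e_i v_k = [ecoef i k] v_(k-1). For the long root i' = i + 1, and the guard
    prevents the single matrix unit from being counted twice. *)
Definition ecoef i (k : nat) : K :=
  (k == i.+1)%:R - ((i.+1 < n) && (k == op n i))%N%:R.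

Lemma ecoef_cases i k : ecoef i k = 0 \/
  [\/ k = i.+1 /\ ecoef i k = 1 | [/\ (i.+1 < n)%N, k = op n i & ecoef i k = -1]].
Proof.
rewrite /ecoef; have iN := ltn_ord i; have [->|ki] := eqVneq k i.+1.
  right; left; split=> //; rewrite [X in _ - X%:R](_ : _ = 0%N) ?subr0 //.
  by rewrite /op; lia.
case: (boolP (_ && _)) => [/andP[h /eqP->]|_]; last by left; rewrite subr0.
by right; right; rewrite h sub0r.
Qed.

(** Makes the truncated predecessor harmless: every term written with [k.-1] carries coefficient 0
    at k = 0. [ecoefN] plays the same role at the upper end. *)
Lemma ecoef0 i : ecoef i 0 = 0.
Proof.
have iN := ltn_ord i; rewrite /ecoef sub0r; apply/eqP; rewrite oppr_eq0.
by rewrite [X in X%:R](_ : _ = 0%N) // /op; lia.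
Qed.

Lemma ecoefN i : ecoef i N = 0.
Proof.
have iN := ltn_ord i; rewrite /ecoef.
have -> : N == i.+1 = false by lia.
have -> : N == op n i = false by rewrite /op; lia.
by rewrite andbF subrr.
Qed.

Lemma wt_pred i k : ecoef i k != 0 -> wt k.-1 = wt k + alpha i.
Proof.
have iN := ltn_ord i; case: (ecoef_cases i k) => [->|]; first by rewrite eqxx.
rewrite /V_weight /alpha => -[[-> _] _|[h -> _ _]] /=.
  rewrite iN; case: ifP => h; first by rewrite addrC subrK.
  by rewrite (_ : op n i.+1 = i) ?mulr2n ?addKr //; rewrite /op; lia.
rewrite h (_ : (op n i).-1 < n = false)%N; last by rewrite /op; lia.
rewrite (_ : op n i < n = false)%N; last by rewrite /op; lia.
rewrite (_ : op n (op n i) = i); last by rewrite /op; lia.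
rewrite (_ : op n (op n i).-1 = i.+1); last by rewrite /op; lia.
by rewrite addKr.
Qed.

Definition wcoef i k : K := wpair (wt k) (alpha i).

Hypotheses (rh0 : rh != 0) (sh0 : sh != 0).

Lemma wpairDl lambda mu nu : wpair (lambda + mu) nu = wpair lambda nu * wpair mu nu.
Proof.
by rewrite /Defs.wpair /rform /sform form2Dl form2Dr !expfzDr // invfM mulrACA.
Qed.
Lemma wpairDr lambda mu nu : wpair nu (lambda + mu) = wpair nu lambda * wpair nu mu.
Proof.
by rewrite /Defs.wpair /rform /sform form2Dl form2Dr !expfzDr // invfM mulrACA.
Qed.
(** Whenever e_i moves v_k, alpha_i is the weight of v_(k-1) minus that of v_k; torus eigenvalues
    thus become ratios of pairings between weights of V. *)
Lemma wpair_alphaE i k l : ecoef i k != 0 ->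
  wcoef i l = wpair (wt l) (wt k.-1) / wpair (wt l) (wt k).
Proof. by move=> /wt_pred->; rewrite wpairDr mulrC mulKf // wpair_neq0. Qed.
End VectorWeights.

Section ExchangeCoefficients.
Variables (K : fieldType) (rh sh : K) (n : nat).
Local Notation N := (2 * n)%N.
Local Notation wt := (V_weight n).
Local Notation p k l := (wpair rh sh (wt k) (wt l)).
Local Notation t_ := (t_ rh sh n).
Local Notation op := (op n).
Local Notation ecoef := (@ecoef K n).
Local Notation wcoef := (@wcoef K rh sh n).
Implicit Types (i : 'I_n).

Lemma ecoef_op i k : (0 < k <= N)%N ->
  ecoef i (op k.-1) = if (i.+1 < n)%N then - ecoef i k else ecoef i k.
Proof.
move=> kN; have iN := ltn_ord i; rewrite /ecoef /Defs.op.
case: ifP => h /=.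
  rewrite opprB; congr (_%:R - _%:R); lia.
by rewrite h; congr (_%:R - _); lia.
Qed.

Hypotheses (rh0 : rh != 0) (sh0 : sh != 0).

Lemma t_neq0 k : t_ k != 0.
Proof.
rewrite /Defs.t_; case: ifP => _; rewrite ?oppr_eq0 expfz_neq0 //; exact: expf_neq0.
Qed.

Lemma wcoef_op i k : (k < N)%N -> wcoef i (op k) = (wcoef i k)^-1.
Proof. by move=> kN; rewrite /wcoef wt_op // wpairNl. Qed.

Lemma wcoef_neq0 i k : wcoef i k != 0.
Proof. exact: wpair_neq0. Qed.

(* Invariance of the sum of the [t_ k] v_(k') (x) v_k under Delta(e_i). *)
Lemma t_step i k : (0 < k < N)%N ->
  t_ k * (wcoef i (op k) * ecoef i k) = - (t_ k.-1 * ecoef i (op k.-1)).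
Proof.
move=> kN; have iN := ltn_ord i.
rewrite ecoef_op; last by lia.
case: (ecoef_cases K i k) => [->|]; first by rewrite !mulr0; case: ifP;
  rewrite ?oppr0 mulr0 oppr0.
have wE : ecoef i k != 0 -> wcoef i (op k) = rh / sh / p k k.-1.
  move=> ek; have kN' : (k < N)%N by case/andP: kN.
  rewrite wcoef_op // (wpair_alphaE rh0 sh0 _ ek) wpair_wt_diag //.
  by rewrite invf_div.
case=> [[ki e1]|[h ki e1]]; rewrite wE ?e1 ?oppr_eq0 ?oner_neq0 // ki wpair_wt;
  try by rewrite /Defs.op; lia.
  rewrite /vabs /sigma /Defs.t_ /= iN; case: ifP => [h|h].
    rewrite /eps_pair ltnSn gtn_eqF // mul1r expr1z.
    have -> : i.+2%:Z - n%:Z - 1 = (i.+1%:Z - n%:Z - 1) + 1 by lia.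
    by rewrite expfzDr ?expf_neq0 // expr1z; field; rewrite rh0 sh0.
  (* The long root: between i and i + 1 = n the formula for [t_] switches from a power of s to minus
     a power of r. *)
  have nE : n = i.+1 by lia.
  rewrite (_ : op i.+1 = i) ?/Defs.op; last by lia.
  rewrite /eps_pair eqxx mulN1r exprN1.
  have -> : n%:Z - i.+2%:Z = -1 by lia.
  have -> : i.+1%:Z - n%:Z - 1 = -1 by lia.
  by rewrite !exprN1; field; rewrite rh0 sh0.
rewrite h; have [h1 h2] : ((op i < n) = false /\ ((op i).-1 < n) = false)%N by
  rewrite /Defs.op; lia.
rewrite /vabs /sigma /Defs.t_ h1 h2.
rewrite (_ : op (op i) = i); last by rewrite /Defs.op; lia.
rewrite (_ : op (op i).-1 = i.+1); last by rewrite /Defs.op; lia.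
rewrite /eps_pair ltn_eqF // ltnNge leqnSn /= mulrNN mulr1 expr1z.
have -> : n%:Z - (op i).-1.+1%:Z = (n%:Z - (op i).+1%:Z) + 1 by rewrite /Defs.op; lia.
move: (n%:Z - (op i).+1%:Z) => m.
by rewrite expfzDr ?expf_neq0 // expr1z; field; rewrite rh0 sh0 oner_neq0.
Qed.

Local Notation zc := ((rh ^+ 2 - sh ^+ 2) / (rh * sh)).

Lemma wpair_wt_op k : (k < N)%N -> p k (op k) = sh / rh.
Proof. by move=> kN; rewrite wt_op // wpairNr wpair_wt_diag // invf_div. Qed.

(* The coefficient of v_l (x) v_(k-1) in [Delta(e_i), Rhat] (v_k (x) v_l). *)
Lemma exchange_coef i k l : (0 < k < N)%N -> (l < N)%N -> ecoef i k != 0 ->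
  (p k l)^-1 * wcoef i l - zc * (l == op k)%:R * wcoef i l - zc * (l == k.-1)%:R
  + zc * (l == k)%:R * wcoef i k - (p k.-1 l)^-1 + zc * (l == op k.-1)%:R = 0.
Proof.
move=> /andP[k0 kN] lN ek; have k1N : (k.-1 < N)%N by lia.
rewrite !(wpair_alphaE rh0 sh0 _ ek) wpair_wt_diag //.
have opk : (op k < N)%N by rewrite /Defs.op; lia.
have opk1 : (op k.-1 < N)%N by rewrite /Defs.op; lia.
have opopk : op (op k) = k by rewrite /Defs.op; lia.
have opopk1 : op (op k.-1) = k.-1 by rewrite /Defs.op; lia.
have k_neq : k == k.-1 = false by lia.
have k1_neq : k.-1 == k = false by lia.
have k_opk : k == op k = false by rewrite /Defs.op; lia.
have opk_k : op k == k = false by rewrite /Defs.op; lia.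
have k1_opk1 : k.-1 == op k.-1 = false by rewrite /Defs.op; lia.
have opk1_k1 : op k.-1 == k.-1 = false by rewrite /Defs.op; lia.
have opk_opk1 : op k == op k.-1 = false by rewrite /Defs.op; lia.
have opk1_opk : op k.-1 == op k = false by rewrite /Defs.op; lia.
have pN a b : p a b != 0 by exact: wpair_neq0.
(* If k' = k - 1 the special positions of l coincide in pairs. With this case split off, l = k, k -
   1, k', (k-1)' and the generic l are five disjoint cases. *)
have [opkE|opkN] := eqVneq (op k) k.-1.
  have opk1E : op k.-1 = k by rewrite -opkE.
  have p1 : p k k.-1 = sh / rh by rewrite -opkE wpair_wt_op.
  have p2 : p k.-1 k = sh / rh by rewrite -{2}opk1E wpair_wt_op.
  rewrite p1 opk1E opkE; have [->|lk] := eqVneq l k.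
    rewrite k_neq p1 p2 wpair_wt_diag // !mulr1n !mulr0n.
by field; rewrite ?rh0 ?sh0 ?oner_neq0.
  have [->|lk1] := eqVneq l k.-1.
    rewrite ?k_neq p1 ?p2 wpair_wt_diag // ?eqxx ?k1_neq !mulr1n !mulr0n.
    by field; rewrite ?rh0 ?sh0 ?oner_neq0.
  rewrite (wpair_wt_sym rh sh k1N lN) ?opk1E // (wpair_wt_sym rh sh kN lN) ?opkE //
    !mulr0n.
  by have := pN k l; have := pN k.-1 l; move: (p k l) (p k.-1 l) => P Q Q0 P0; field;
    rewrite ?P0 ?Q0 ?rh0 ?sh0 ?oner_neq0.
have k_opk1 : k == op k.-1 = false by move: opkN; rewrite /Defs.op; lia.
have k1_opk : k.-1 == op k = false by rewrite eq_sym (negPf opkN).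
have [->|lk] := eqVneq l k.
  rewrite k_opk k_neq k_opk1.
  rewrite wpair_wt_diag // (wpair_wt_sym rh sh k1N kN) ?k_neq ?k1_neq ?k_opk1 ?k1_opk
    //.
  have := pN k.-1 k. move: (p k.-1 k) => P P0.
  rewrite !mulr1n !mulr0n.
  by field; rewrite ?rh0 ?sh0 ?oner_neq0 ?P0.
have [->|lk1] := eqVneq l k.-1.
  rewrite k1_opk k1_opk1.
  rewrite wpair_wt_diag // (wpair_wt_sym rh sh kN k1N) ?k_neq ?k1_neq ?k_opk1 ?k1_opk
    //.
  have := pN k k.-1. move: (p k k.-1) => P P0.
  rewrite !mulr1n !mulr0n.
  by field; rewrite ?rh0 ?sh0 ?oner_neq0 ?P0.
have [->|lopk] := eqVneq l (op k).
  rewrite opk_opk1 wpair_wt_op // !(wt_op kN) !wpairNl wpairNr wpair_wt_diag //.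
  rewrite (wpair_wt_sym rh sh k1N kN) ?k_neq ?k1_neq ?k_opk1 ?k1_opk //.
  have := pN k.-1 k. move: (p k.-1 k) => P P0.
  rewrite !mulr1n !mulr0n.
  by field; rewrite ?rh0 ?sh0 ?oner_neq0 ?P0.
have [->|lopk1] := eqVneq l (op k.-1).
  rewrite wpair_wt_op // !(wt_op k1N) !wpairNl !wpairNr wpair_wt_diag //.
  rewrite (wpair_wt_sym rh sh k1N kN) ?k_neq ?k1_neq ?k_opk1 ?k1_opk //.
  have := pN k.-1 k. move: (p k.-1 k) => P P0.
  rewrite !mulr1n !mulr0n.
  by field; rewrite ?rh0 ?sh0 ?oner_neq0 ?P0.
rewrite (wpair_wt_sym rh sh k1N lN) // (wpair_wt_sym rh sh kN lN) // !mulr0n.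
by have := pN k l; have := pN k.-1 l; move: (p k l) (p k.-1 l) => P Q Q0 P0; field;
  rewrite ?P0 ?Q0 ?rh0 ?sh0 ?oner_neq0.
Qed.
End ExchangeCoefficients.

Section ExplicitRhat.
Variables (K : fieldType) (rh sh : K) (n : nat).
Local Notation N := (2 * n)%N.
Local Notation wt := (V_weight n).
Local Notation p k l := (wpair rh sh (wt k) (wt l)).
Local Notation t_ := (t_ rh sh n).
Local Notation op := (op n).
Local Notation E := (@E K n).
Local Notation ecoef := (@ecoef K n).
Local Notation wcoef := (@wcoef K rh sh n).
Local Notation bvec := (@bvec K n).
Local Notation bvec2 := (@bvec2 K n).
Implicit Types (i : 'I_n).
Local Notation zc := ((rh ^+ 2 - sh ^+ 2) / (rh * sh)).

Lemma V_e_bvec i k : (k < N)%N -> V_e K i *m bvec k = ecoef i k *: bvec k.-1.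
Proof.
move=> kN; have iN := ltn_ord i; rewrite /V_e /ecoef; case: ifP => h /=.
  rewrite mulmxBl !mul_E_bvec // scalerBl [k == i.+1]eq_sym [k == op i]eq_sym.
  congr (_ - _).
    by case: eqP => [<-|_]; rewrite ?scale0r.
  case: eqP => [<-|_]; rewrite ?scale0r //.
  by congr (_ *: bvec _); rewrite /Defs.op; lia.
rewrite mul_E_bvec // subr0 (_ : op i = i.+1); last by rewrite /Defs.op; lia.
by rewrite [k == _]eq_sym; case: eqP => [<-|_]; rewrite ?scale0r.
Qed.

Lemma V_w_bvec i k : (k < N)%N -> V_w rh sh i *m bvec k = wcoef i k *: bvec k.
Proof.
move=> kN; rewrite /V_w mulmx_suml.
rewrite -(sum_delta (fun a => wcoef i a *: bvec a) kN); apply: eq_bigr => a _.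
by rewrite -scalemxAl mul_E_bvec // !scalerA mulrC.
Qed.

Definition Delta_e i : 'M[K]_(N * N) := V_e K i *t 1%:M + V_w rh sh i *t V_e K i.

Lemma Delta_e_bvec2 i k l : (k < N)%N -> (l < N)%N ->
  Delta_e i *m bvec2 k l =
  ecoef i k *: bvec2 k.-1 l + (wcoef i k * ecoef i l) *: bvec2 k l.-1.
Proof.
move=> kN lN; rewrite /Delta_e mulmxDl !tensmx_mul mul1mx V_w_bvec // !V_e_bvec //.
by rewrite tens_scale -[bvec l in LHS]scale1r tens_scale mulr1.
Qed.

Definition flip_coef k l : K := (p k l)^-1.

Lemma tau_bvec2 k l : (k < N)%N -> (l < N)%N -> tau_VV K n *m bvec2 k l = bvec2 l k.
Proof.
move=> kN lN; rewrite /tau_VV mulmx_suml -(scale1r (bvec2 l k)).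
rewrite -[RHS](sum2_delta (fun _ _ => true) (fun a b => bvec2 a b) kN lN).
apply: eq_bigr => i _; rewrite mulmx_suml; apply: eq_bigr => j _.
by rewrite mul_E2_bvec2.
Qed.

Lemma diag2_bvec2 (c : nat -> nat -> K) k l : (k < N)%N -> (l < N)%N ->
  (\sum_(a < N) \sum_(b < N) c a b *: (E a a *t E b b)) *m bvec2 k l = c k l *: bvec2
    k l.
Proof.
move=> kN lN; rewrite mulmx_suml -[RHS]scale1r.
rewrite -[RHS](sum2_delta (fun _ _ => true) (fun a b => c a b *: bvec2 a b) lN kN).
apply: eq_bigr => i _; rewrite mulmx_suml; apply: eq_bigr => j _.
by rewrite -scalemxAl mul_E2_bvec2 // !scalerA mulrC andbC.
Qed.

Lemma flip_bvec2 k l : (k < N)%N -> (l < N)%N ->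
  (ftilde_VV rh sh n *m tau_VV K n) *m bvec2 k l = flip_coef k l *: bvec2 l k.
Proof.
move=> kN lN; rewrite -mulmxA tau_bvec2 //.
exact: (diag2_bvec2 (fun a b => f_weight rh sh (wt a) (wt b))).
Qed.

(** A truncation of the invariant tensor. The last sum of [Rhat] maps v_k (x) v_(k') to this vector
    divided by t_k, without its v_k (x) v_(k') term and up to the global scalar. *)
Definition bvec2_sum k : 'M[K]_(N * N, 1 * 1) := \sum_(i < k) t_ i *: bvec2 (op i) i.

Lemma bvec2_sumS k : bvec2_sum k.+1 = bvec2_sum k + t_ k *: bvec2 (op k) k.
Proof. exact: big_ord_recr. Qed.

Hypotheses (rh0 : rh != 0) (sh0 : sh != 0).

(** The first three sums of [Rhat] combine into the scaled flip. The constant r^(n+1-i) s^(i-n-1) in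
    the fourth equals -t_i / t_(i'): it supplies the term excluded from the last sum by j <> i',
    leaving the uniform coefficient for l < k and a complete truncation of the invariant tensor. *)
Lemma Rhat_bvec2 k l : (k < N)%N -> (l < N)%N ->
  Rhat rh sh n *m bvec2 k l =
  flip_coef k l *: bvec2 l k - (zc * (l < k)%N%:R) *: bvec2 k l
  + (zc * (l == op k)%:R / t_ k) *: bvec2_sum k.
Proof.
move=> kN lN; rewrite /Rhat !mulmxDl -!scalemxAl.
have -> : (\sum_(i < N) E i i *t E i i) *m bvec2 k l = (l == k)%:R *: bvec2 l k.
  rewrite mulmx_suml; transitivity ((k == l)%:R *: bvec2 k k).
    rewrite -(sum_delta (fun a => (a == l)%:R *: bvec2 a a) kN).
    by apply: eq_bigr => i _; rewrite mul_E2_bvec2 // scalerA -natrM mulnb.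
  by rewrite eq_sym; case: eqP => [->|_]; rewrite ?scale0r.
have -> : (\sum_(i < N) E i (op i) *t E (op i) i) *m bvec2 k l = (l == op k)%:R *:
  bvec2 l k.
  rewrite mulmx_suml; transitivity ((op l == k)%:R *: bvec2 l (op l)).
    rewrite -(sum_delta (fun a => (op a == k)%:R *: bvec2 a (op a)) lN).
    by apply: eq_bigr => i _; rewrite mul_E2_bvec2 // scalerA -natrM mulnb andbC.
  rewrite (_ : op l == k = (l == op k)); last by rewrite /Defs.op; lia.
  by case: eqP => [->|_]; rewrite ?scale0r // (_ : op (op k) = k) // /Defs.op; lia.
have -> : (\sum_(i < N) \sum_(j < N | (j != i :> nat) && (j != op i :> nat))
      a_ rh sh n i j *: (E i j *t E j i)) *m bvec2 k l =
   (((k != l) && (k != op l))%:R * a_ rh sh n l k) *: bvec2 l k.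
  rewrite -scalerA mulmx_suml -(sum2_delta (fun a b => (b != a) && (b != op a))
    (fun a b => a_ rh sh n a b *: bvec2 a b) kN lN).
  apply: eq_bigr => i _; rewrite mulmx_suml; apply: eq_bigr => j _.
  by rewrite -scalemxAl mul_E2_bvec2 // !scalerA mulrC.
have -> : (\sum_(i < n) (rh ^+ 2 ^ (n%:Z + 1 - i.+1%:Z) * sh ^+ 2 ^ (i.+1%:Z - n%:Z -
  1) + 1)
        *: (E (op i) (op i) *t E i i)) *m bvec2 k l =
  (((l < n)%N && (k == op l))%:R * (rh ^+ 2 ^ (n%:Z + 1 - l.+1%:Z) * sh ^+ 2 ^
    (l.+1%:Z - n%:Z - 1) + 1))
        *: bvec2 k l.
  rewrite mulmx_suml; case: (ltnP l n) => [ln|nl]; last first.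
    rewrite mul0r scale0r big1 // => i _; rewrite -scalemxAl mul_E2_bvec2 //.
    by rewrite [i == l :> nat]ltn_eqF ?andbF ?scale0r ?scaler0 //; apply: leq_trans nl.
  transitivity ((op l == k)%:R *: ((rh ^+ 2 ^ (n%:Z + 1 - l.+1%:Z) * sh ^+ 2 ^
    (l.+1%:Z - n%:Z - 1) + 1)
        *: bvec2 (op l) l)); last first.
    by rewrite [op l == k]eq_sym /= -scalerA; case: eqP => [->|_]; rewrite ?scale0r.
  rewrite -(sum_delta (fun a => (op a == k)%:R *: ((rh ^+ 2 ^ (n%:Z + 1 - a.+1%:Z) *
    sh ^+ 2 ^ (a.+1%:Z - n%:Z - 1) + 1)
        *: bvec2 (op a) a)) ln).
  apply: eq_bigr => i _; rewrite -scalemxAl mul_E2_bvec2 // [RHS]scalerA -natrM mulnb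
    andbC.
  by rewrite !scalerA mulrC.
have -> : (\sum_(i < N) \sum_(j < N | (j < i)%N && (j != op i :> nat)) E i i *t E j
  j) *m bvec2 k l =
  ((l < k)%N && (l != op k))%:R *: bvec2 k l.
  rewrite mulmx_suml -(sum2_delta (fun a b => (b < a)%N && (b != op a))
    (fun a b => bvec2 a b) lN kN).
  apply: eq_bigr => i _; rewrite mulmx_suml; apply: eq_bigr => j _.
  by rewrite mul_E2_bvec2 // andbC.
have -> : (\sum_(i < N) \sum_(j < N | (i < j)%N && (j != op i :> nat))
        (t_ i / t_ j) *: (E (op i) j *t E i (op j))) *m bvec2 k l =
  ((l == op k)%:R / t_ k) *: (bvec2_sum k - ((l < k)%N%:R * t_ l) *: bvec2 k l).
  transitivity (\sum_(i < N) (((i < k)%N && (k != op i))%:R * (l == op k)%:R * (t_ i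
    / t_ k)) *: bvec2 (op i) i).
    rewrite mulmx_suml; apply: eq_bigr => i _; rewrite mulmx_suml big_mkcond /=.
    rewrite -!mulrA -scalerA.
    rewrite -[RHS](sum_delta (fun b => ((i < b)%N && (b != op i))%:R *: (((l == op
      b)%:R * (t_ i / t_ b)) *: bvec2 (op i) i)) kN).
    apply: eq_bigr => j _; case: (_ && (_ != _)); last by rewrite scale0r scaler0.
    rewrite scale1r -scalemxAl mul_E2_bvec2 // [l == _]eq_sym. 
    by rewrite -[in RHS]scalerA [RHS]scalerA -natrM mulnb !scalerA mulrC.
  have [lE|_] := eqVneq l (op k); last first.
    by rewrite mul0r scale0r big1 // => i _; rewrite mulr0 mul0r scale0r.
  have opl : op l = k by rewrite lE /Defs.op; lia.
  rewrite /bvec2_sum (big_ord_widen N (fun a => t_ a *: bvec2 (op a) a));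
    last exact: ltnW.
  rewrite -[((l < k)%N%:R * t_ l) *: _]scalerA (_ : bvec2 k l = bvec2 (op l) l);
    last by rewrite opl.
  rewrite -(sum_delta (fun a => (a < k)%N%:R *: (t_ a *: bvec2 (op a) a)) lN).
  rewrite [in RHS]big_mkcond -sumrB scaler_sumr; apply: eq_bigr => i _ /=.
  have -> : (k != op i) = (i != l :> nat).
    by rewrite lE /Defs.op; have := ltn_ord i; lia.
  rewrite !mulr1 div1r; case: (i < k)%N; last first.
    by rewrite !mul0r !scale0r scaler0 subr0 scaler0.
  case: eqP => _ /=; first by rewrite !mul0r !scale1r subrr scale0r scaler0.
  by rewrite scale0r subr0 scalerA mul1r mulrC.
have flipE : flip_coef k l = rh^-1 * sh * (l == k)%:R + rh * sh^-1 * (l == op k)%:R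
    + ((k != l) && (k != op l))%:R * a_ rh sh n l k.
  rewrite /flip_coef (_ : k == op l = (l == op k)); last by rewrite /Defs.op; lia.
  have k_opk : k == op k = false by rewrite /Defs.op; lia.
  have [->|lk] := eqVneq l k.
    by rewrite k_opk wpair_wt_diag // invf_div mulr0 mul0r !addr0 mulr1 mulrC.
  have [->|lopk] := eqVneq l (op k).
    by rewrite wpair_wt_op // invf_div !mulr0 mul0r add0r addr0 mulr1.
  by rewrite wpair_wt_a // !mulr0 !add0r mul1r.
have coefE : zc * (l < k)%N%:R = zc * (((l < n)%N && (k == op l))%:R *
    (rh ^+ 2 ^ (n%:Z + 1 - l.+1%:Z) * sh ^+ 2 ^ (l.+1%:Z - n%:Z - 1) + 1)
    + ((l < k)%N && (l != op k))%:R + (l == op k)%:R / t_ k * ((l < k)%N%:R * t_ l)).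
  congr (_ * _); rewrite (_ : k == op l = (l == op k)); last by rewrite /Defs.op; lia.
  have [lE|_] := eqVneq l (op k); last by rewrite !andbF andbT !mul0r addr0 add0r.
  rewrite (_ : l < k = (l < n) :> bool)%N; last by rewrite lE /Defs.op; lia.
  case: (ltnP l n) => ln; last by rewrite !mul0r mulr0 !addr0.
  rewrite /Defs.t_ ln ifF; last by move: lE ln; rewrite /Defs.op; lia.
  have -> : n%:Z - k.+1%:Z = - (n%:Z + 1 - l.+1%:Z) by move: lE; rewrite /Defs.op; lia.
  rewrite -!invr_expz; move: (n%:Z + 1 - l.+1%:Z) (_ - 1) => u v /=.
  have : rh ^+ 2 ^ u != 0 by rewrite expfz_neq0 ?expf_neq0.
  by move: (rh ^+ 2 ^ u) => x x0; field; rewrite x0 oppr_eq0 oner_neq0.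
rewrite flipE coefE; move: (bvec2_sum k) (bvec2 l k) (bvec2 k l) => S b1 b2.
apply/matrixP => u v; rewrite !mxE.
move: (S u v) (b1 u v) (b2 u v) => S' b1' b2'.
have := t_neq0 n rh0 sh0 k; move: (t_ k) => tk tk0.
field; by rewrite tk0 rh0 sh0.
Qed.

(** Telescoping: by [t_step] the contributions of consecutive terms cancel, and only the boundary of
    the truncation remains. *)
Lemma Delta_e_bvec2_sum i k : (0 < k < N)%N ->
  Delta_e i *m bvec2_sum k = (t_ k.-1 * ecoef i (op k.-1)) *: bvec2 (op k) k.-1.
Proof.
case: k => // k kN; rewrite [k.+1.-1]/=.
elim: k kN => [|k IHk] kN.
  rewrite /bvec2_sum big_ord_recr big_ord0 /= add0r -scalemxAr Delta_e_bvec2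
    ?/Defs.op; try lia.
  by rewrite ecoef0 mulr0 scale0r addr0 scalerA; congr (_ *: bvec2 _ _); lia.
rewrite {1}/bvec2_sum big_ord_recr /= -/(bvec2_sum _) mulmxDr IHk; last by lia.
rewrite -scalemxAr Delta_e_bvec2; [|by rewrite /Defs.op; lia|by lia].
rewrite scalerDr !scalerA (t_step rh0 sh0); last by lia.
rewrite scaleNr [k.+1.-1]/= addrC subrK; congr (_ *: bvec2 _ _).
by rewrite /Defs.op; lia.
Qed.

(** Raising the second weight by alpha_i changes the flip coefficient by exactly the inverse of the
    eigenvalue of w_i on v_k, so the flip absorbs the w_i of Delta(e_i). *)
Lemma flip_coef_pred i k l : ecoef i l != 0 ->
  wcoef i k * flip_coef k l.-1 = flip_coef k l.
Proof.
move=> el; rewrite (wpair_alphaE rh0 sh0 _ el) /flip_coef mulrAC mulfV ?mul1r //.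
exact: wpair_neq0.
Qed.

(** Compared on v_k (x) v_l, the two sides agree apart from multiples of v_l (x) v_(k-1), coming
    from all parts of [Rhat]; [exchange_coef] says that these add up to zero. *)
Lemma Delta_e_Rhat i : Delta_e i *m Rhat rh sh n = Rhat rh sh n *m Delta_e i.
Proof.
apply: matrix_bvec2P => k l kN lN; rewrite -[LHS]mulmxA -[RHS]mulmxA.
have k1N : (k.-1 < N)%N by lia.
have l1N : (l.-1 < N)%N by lia.
rewrite Rhat_bvec2 // Delta_e_bvec2 // [RHS]mulmxDr -!scalemxAr !Rhat_bvec2 //.
rewrite !(mulmxDr (Delta_e i)) mulmxN -!scalemxAr !Delta_e_bvec2 //.
have E5 : wcoef i k * ecoef i l * flip_coef k l.-1 = flip_coef k l * ecoef i l.
  have [->|el] := eqVneq (ecoef i l) 0; first by rewrite !(mulr0, mul0r).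
  by rewrite -(flip_coef_pred k el) mulrAC.
(* At k = 0 only the scaled flip is left, and v_(k-1) does not exist. *)
have [k0|k0] := posnP k.
  rewrite k0 in E5 *; rewrite ecoef0 /bvec2_sum !big_ord0 mulmx0 !scaler0 !scale0r
    !addr0 !add0r !ltn0.
  rewrite !mulr0 !scale0r !subr0 addr0 !scalerA.
  by rewrite -E5.
have kN' : (0 < k < N)%N by rewrite k0.
have E1 : (zc * (l == op k)%:R / t_ k) *: (Delta_e i *m bvec2_sum k) =
    - (zc * (l == op k)%:R * wcoef i l * ecoef i k) *: bvec2 l k.-1.
  rewrite Delta_e_bvec2_sum // -[t_ k.-1 * _]opprK -(t_step rh0 sh0) //.
  have [->|_] := eqVneq l (op k); last by rewrite !(mulr0, mul0r, scale0r, oppr0).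
  rewrite scalerA; congr (_ *: _).
  have := t_neq0 n rh0 sh0 k; move: (t_ k) => tk tk0.
  by field; rewrite tk0 rh0 sh0.
(* The indicator of l < k changes at a single position when k or l drops by one; the discrepancy in
   [E2] and [E3] is a multiple of v_l (x) v_(k-1). *)
have E2 : (l < k)%N%:R *: bvec2 k.-1 l =
    (l < k.-1)%N%:R *: bvec2 k.-1 l + (l == k.-1)%:R *: bvec2 l k.-1.
  have -> : (l < k)%N = (l < k.-1)%N || (l == k.-1) by lia.
  by case: eqP => [->|_]; rewrite ?ltnn ?orbF /= ?scale1r ?scale0r ?add0r ?addr0.
have E3 : (ecoef i l * (l < k)%N%:R) *: bvec2 k l.-1 =
    (ecoef i l * (l.-1 < k)%N%:R) *: bvec2 k l.-1
    - (ecoef i k * (l == k)%:R) *: bvec2 l k.-1.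
  have [->|l0] := posnP l; first by rewrite ecoef0 !mul0r (_ : 0%N == k = false)
    ?mulr0 ?scale0r ?subr0 //; lia.
  have -> : (l.-1 < k)%N = (l < k)%N || (l == k) by lia.
  by case: eqP => [->|_]; rewrite ?ltnn ?orbF ?orbT /= ?mulr0 ?mulr1 ?scale0r ?subrr
    ?subr0.
have E4 : (ecoef i k * (zc * (l == op k.-1)%:R / t_ k.-1)) *: bvec2_sum k.-1
    + (wcoef i k * ecoef i l * (zc * (l.-1 == op k)%:R / t_ k)) *: bvec2_sum k =
    - (zc * (l == op k.-1)%:R * ecoef i k) *: bvec2 l k.-1.
  have [l0|l0] := posnP l.
    rewrite l0 ecoef0 (_ : 0%N == op k.-1 = false); last by rewrite /Defs.op; lia.
    by rewrite !(mulr0, mul0r, scale0r, addr0, oppr0).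
  rewrite (_ : l.-1 == op k = (l == op k.-1)); last by rewrite /Defs.op; lia.
  have [lE|_] := eqVneq l (op k.-1); last first.
    by rewrite !(mulr0, mul0r, scale0r, addr0, oppr0).
  have := t_step rh0 sh0 i kN'; rewrite wcoef_op // -lE => tE.
  have := wcoef_neq0 rh0 sh0 i k; move: tE.
  have := t_neq0 n rh0 sh0 k; have := t_neq0 n rh0 sh0 k.-1.
  have -> : bvec2_sum k = bvec2_sum k.-1 + t_ k.-1 *: bvec2 l k.-1.
    by rewrite -{1}(prednK k0) bvec2_sumS lE.
  move: (t_ k) (t_ k.-1) (wcoef i k) => tk t' a t'0 tk0 tE a0.
  have -> : ecoef i l = - (tk * (a^-1 * ecoef i k) / t').
    by rewrite tE mulNr opprK mulrC mulKf.
  apply/matrixP => u v; rewrite !mxE.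
  by field; rewrite t'0 tk0 a0 rh0 sh0.
have E6 : ecoef i k * (flip_coef k l * wcoef i l - zc * (l == op k)%:R * wcoef i l
    - zc * (l == k.-1)%:R + zc * (l == k)%:R * wcoef i k - flip_coef k.-1 l
    + zc * (l == op k.-1)%:R) = 0.
  have [->|ek] := eqVneq (ecoef i k) 0; first by rewrite mul0r.
  by rewrite [X in _ * X](exchange_coef rh0 sh0 kN' lN ek) mulr0.
rewrite E1; move: E2 E3 E4 {E1}.
move: (bvec2_sum k) (bvec2_sum k.-1) (bvec2 k l.-1) (bvec2 k.-1 l)
  (bvec2 l.-1 k) (bvec2 l k.-1) => S S' b1 b2 b3 b4 E2 E3 E4.
apply/matrixP => u v; move: E2 E3 E4 => /matrixP/(_ u v) E2 /matrixP/(_ u v) E3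
  /matrixP/(_ u v) E4.
move: E2 E3 E4 E5 E6; rewrite !mxE.
move: (S u v) (S' u v) (b1 u v) (b2 u v) (b3 u v) (b4 u v) => {S b1 b2 b3 b4}S {}S'
  b1 b2 b3 b4.
move: zc (t_ k)^-1 (t_ k.-1)^-1 => z tk t'.
move: (flip_coef k l) (flip_coef k l.-1) (flip_coef k.-1 l) (ecoef i l) (ecoef i k)
  (wcoef i l) (wcoef i k) => g g1 g2 el ek wl wk.
move=> /eqP; rewrite -subr_eq0 => /eqP E2 /eqP; rewrite -subr_eq0 => /eqP E3.
move=> /eqP; rewrite -subr_eq0 => /eqP E4 /eqP; rewrite -subr_eq0 => /eqP E5 E6.
apply/eqP; rewrite -subr_eq0; apply/eqP.
move: E2 E3 E4 E5 E6.
set A2 := (X in X = 0 -> _); set A3 := (X in _ -> X = 0 -> _).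
set A4 := (X in _ -> _ -> X = 0 -> _); set A5 := (X in _ -> _ -> _ -> X = 0 -> _).
set A6 := (X in _ -> _ -> _ -> _ -> X = 0 -> _) => E2 E3 E4 E5 E6.
(* An explicit certificate: the difference of the two sides as a combination of the five vanishing
   expressions. *)
transitivity (b4 * A6 - b3 * A5 - z * ek * A2 - z * wk * A3 - A4).
  by rewrite /A2 /A3 /A4 /A5 /A6; ring.
by rewrite E2 E3 E4 E5 E6 !mulr0 !subr0.
Qed.
End ExplicitRhat.

(** * Intertwiners of V (x) V *)

Section Intertwiners.
Variables (K : fieldType) (rh sh : K) (n : nat).
Local Notation N := (2 * n)%N.
Local Notation wt := (V_weight n).
Local Notation op := (op n).
Local Notation E := (@E K n).
Local Notation ecoef := (@ecoef K n).
Local Notation wcoef := (@wcoef K rh sh n).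
Local Notation bvec := (@bvec K n).
Local Notation bvec2 := (@bvec2 K n).
Local Notation bcov := (@bcov K n).
Local Notation bcov2 := (@bcov2 K n).
Implicit Types (i : 'I_n).
Local Notation Delta_e := (@Delta_e K rh sh n).
Local Notation flip_coef := (@flip_coef K rh sh n).

Lemma bcov_V_e i k : (k < N)%N -> bcov k *m V_e K i = ecoef i k.+1 *: bcov k.+1.
Proof.
move=> kN; have iN := ltn_ord i; rewrite /V_e /ecoef eqSS; case: ifP => h /=.
  rewrite mulmxBr !mul_bcov_E // scalerBl; congr (_ - _).
    by case: eqP => [->|_]; rewrite ?scale0r.
  rewrite (_ : k.+1 == op i = (k == op i.+1)); last by rewrite /Defs.op; lia.
  case: eqP => [->|_]; rewrite ?scale0r //.
  by congr (_ *: bcov _); rewrite /Defs.op; lia.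
rewrite mul_bcov_E // subr0 (_ : op i = i.+1); last by rewrite /Defs.op; lia.
by case: eqP => [->|_]; rewrite ?scale0r.
Qed.

Lemma bcov_V_w i k : (k < N)%N -> bcov k *m V_w rh sh i = wcoef i k *: bcov k.
Proof.
move=> kN; rewrite /V_w mulmx_sumr.
rewrite -(sum_delta (fun a => wcoef i a *: bcov a) kN); apply: eq_bigr => a _.
by rewrite -scalemxAr mul_bcov_E // !scalerA mulrC [k == _]eq_sym.
Qed.

Lemma bcov2_Delta_e i k l : (k < N)%N -> (l < N)%N -> bcov2 k l *m Delta_e i =
  ecoef i k.+1 *: bcov2 k.+1 l + (wcoef i k * ecoef i l.+1) *: bcov2 k l.+1.
Proof.
move=> kN lN; rewrite /Delta_e mulmxDr !tensmx_mul mulmx1 bcov_V_w // !bcov_V_e //.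
by rewrite tens_scale -[bcov l in LHS]scale1r tens_scale mulr1.
Qed.

Lemma ecoef_ex k : (k.+1 < N)%N -> exists i, ecoef i k.+1 != 0.
Proof.
move=> kN; have [kn|nk] := ltnP k n.
  exists (Ordinal kn); rewrite /ecoef eqxx.
  rewrite (_ : (_ && _) = false) ?subr0 ?oner_neq0 //= /Defs.op; lia.
have jn : (op k.+1 < n)%N by rewrite /Defs.op; lia.
exists (Ordinal jn); rewrite /ecoef.
rewrite (_ : k.+1 == (Ordinal jn).+1 = false) /=; last by rewrite /= /Defs.op; lia.
rewrite (_ : (_ && _) = true) ?sub0r ?oppr_eq0 ?oner_neq0 // /Defs.op; lia.
Qed.

Definition highest_proj : 'M[K]_(N * N) := E 0 0 *t 1%:M.

Lemma bcov2_highest_proj l : (0 < N)%N -> bcov2 0 l *m highest_proj = bcov2 0 l.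
Proof.
move=> N0; rewrite /bcov2 /highest_proj tensmx_mul mulmx1 mul_bcov_E //.
by rewrite eqxx scale1r.
Qed.

(* As the e_i of V link all rows, the row space of an intertwiner is
   determined by its rows in the highest weight line of the first factor. *)
Lemma intertwiner_eq0 (X : 'M[K]_(N * N)) (Y : 'I_n -> 'M[K]_(N * N)) :
  (forall i, Delta_e i *m X = X *m Y i) -> highest_proj *m X = 0 -> X = 0.
Proof.
move=> XY PX.
suff H k l : (k < N)%N -> (l < N)%N -> bcov2 k l *m X = 0.
  by apply: matrix_bcov2P => k l kN lN; rewrite H // mulmx0.
elim: k l => [|k IHk] l kN lN.
  by rewrite -bcov2_highest_proj // -mulmxA PX mulmx0.
have kN' := ltnW kN; have [i ek] := ecoef_ex kN.
have := congr1 (mulmx (bcov2 k l)) (XY i).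
rewrite !mulmxA IHk // mul0mx bcov2_Delta_e // mulmxDl -!scalemxAl.
have -> : (wcoef i k * ecoef i l.+1) *: (bcov2 k l.+1 *m X) = 0.
  have [lN'|lN'] := ltnP l.+1 N; first by rewrite IHk // scaler0.
  by rewrite (_ : l.+1 = N) ?ecoefN ?mulr0 ?scale0r //; lia.
move=> /eqP; rewrite addr0 scaler_eq0 (negPf ek) /= => /eqP ->.
by [].
Qed.

Local Notation G := (ftilde_VV rh sh n *m tau_VV K n).

Definition w'coef i k : K := (wpair rh sh (alpha i) (wt k))^-1.

Lemma V_w'_bvec i k : (k < N)%N -> V_w' rh sh i *m bvec k = w'coef i k *: bvec k.
Proof.
move=> kN; rewrite /V_w' mulmx_suml.
rewrite -(sum_delta (fun a => w'coef i a *: bvec a) kN); apply: eq_bigr => a _.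
by rewrite -scalemxAl mul_E_bvec // !scalerA mulrC.
Qed.

Definition fcoef i (k : nat) : K :=
  if (i.+1 < n)%N then (k == i)%:R - (rh ^+ 2 * sh ^+ 2)^-1 * (k == op i.+1)%:R
  else (rh ^+ 2 * sh ^+ 2)^-1 * (k == i)%:R.

Lemma V_f_bvec i k : (k < N)%N -> V_f rh sh i *m bvec k = fcoef i k *: bvec k.+1.
Proof.
move=> kN; have iN := ltn_ord i; rewrite /V_f /fcoef; case: ifP => h.
  rewrite mulmxBl -scalemxAl !mul_E_bvec // scalerBl -scalerA.
  rewrite [k == i :> nat]eq_sym [k == op i.+1]eq_sym.
  congr (_ - _ *: _).
    by case: eqP => [->|_]; rewrite ?scale0r.
  case: eqP => [<-|_]; rewrite ?scale0r //.
  by congr (_ *: bvec _); rewrite /Defs.op; lia.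
rewrite -scalemxAl mul_E_bvec // scalerA (_ : op i = i.+1); last by rewrite /Defs.op;
  lia.
by rewrite [k == _]eq_sym; case: eqP => [->|_]; rewrite ?mulr0 ?scale0r.
Qed.

Lemma fcoef_ecoef i k : fcoef i k != 0 -> ecoef i k.+1 != 0.
Proof.
have iN := ltn_ord i; rewrite /fcoef /ecoef eqSS; case: ifP => h /=.
  rewrite (_ : k.+1 == op i = (k == op i.+1)); last by rewrite /Defs.op; lia.
  have [->|_] := eqVneq k i.
    by rewrite (_ : (i : nat) == op i.+1 = false) ?subr0 ?oner_neq0 // /Defs.op; lia.
  have [_|_] := eqVneq k (op i.+1); first by move=> _; rewrite sub0r oppr_eq0 oner_neq0.
  by rewrite mulr0 subr0 eqxx.
have [_|_] := eqVneq k i; last by rewrite mulr0 eqxx.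
by move=> _; rewrite subr0 oner_neq0.
Qed.

Lemma flip_diag (D : 'M[K]_N) (d : nat -> K) :
  (forall k, (k < N)%N -> D *m bvec k = d k *: bvec k) ->
  G *m (D *t D) = (D *t D) *m G.
Proof.
move=> Dd; apply: matrix_bvec2P => k l kN lN; rewrite -[LHS]mulmxA -[RHS]mulmxA.
rewrite flip_bvec2 // -scalemxAr !tensmx_mul !Dd // !tens_scale -scalemxAr flip_bvec2
  //.
by rewrite !scalerA mulrC [d k * _]mulrC.
Qed.

Lemma highest_proj_diag (D : 'M[K]_N) (d : nat -> K) :
  (forall k, (k < N)%N -> D *m bvec k = d k *: bvec k) ->
  highest_proj *m (D *t D) = (D *t D) *m highest_proj.
Proof.
move=> Dd; have DE : E 0 0 *m D = D *m E 0 0.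
  apply: matrix_bvecP => k kN; rewrite -!mulmxA Dd // -scalemxAr mul_E_bvec //.
  rewrite -scalemxAr; case: eqP => [<-|_]; last by rewrite !scale0r scaler0.
  by rewrite !scale1r Dd //; lia.
by rewrite /highest_proj !tensmx_mul mulmx1 mul1mx DE.
Qed.

Lemma highest_proj_V_f i : E 0 0 *m V_f rh sh i = 0.
Proof.
apply/matrixP => a b; rewrite !mxE big1 // => k _; rewrite [E _ _ _ _]mxE.
have [k0|_] := eqVneq (k : nat) 0%N; last by rewrite andbF mul0r.
by rewrite V_f_lower ?mulr0 // k0.
Qed.

Hypotheses (rh0 : rh != 0) (sh0 : sh != 0).

Lemma flip_coef_pred' i k l : ecoef i k != 0 ->
  flip_coef k.-1 l = flip_coef k l * (wpair rh sh (alpha i) (wt l))^-1.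
Proof. by move=> ek; rewrite /flip_coef (wt_pred ek) wpairDl // invfM. Qed.

(** Passing through the scaled flip, Delta(e_i) becomes the factor that stands to the right of Theta
    in its intertwining identity. *)
Lemma flip_Delta_e i :
  G *m Delta_e i = (V_e K i *t 1%:M + V_w' rh sh i *t V_e K i) *m G.
Proof.
apply: matrix_bvec2P => k l kN lN; rewrite -[LHS]mulmxA -[RHS]mulmxA.
have k1N : (k.-1 < N)%N by lia.
have l1N : (l.-1 < N)%N by lia.
rewrite flip_bvec2 // Delta_e_bvec2 // mulmxDr -!scalemxAr !flip_bvec2 //.
rewrite mulmxDl !tensmx_mul mul1mx V_w'_bvec // !V_e_bvec // tens_scale.
rewrite -[bvec k in RHS]scale1r tens_scale mulr1 scalerDr !scalerA addrC.
congr (_ *: _ + _ *: _).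
  have [->|el] := eqVneq (ecoef i l) 0; first by rewrite !(mulr0, mul0r).
  by rewrite -(flip_coef_pred rh0 sh0 k el) mulrAC.
have [->|ek] := eqVneq (ecoef i k) 0; first by rewrite !(mulr0, mul0r).
by rewrite (flip_coef_pred' l ek) /w'coef; ring.
Qed.

Lemma flip_Delta_f i :
  G *m (1%:M *t V_f rh sh i + V_f rh sh i *t V_w' rh sh i) =
  (1%:M *t V_f rh sh i + V_f rh sh i *t V_w rh sh i) *m G.
Proof.
apply: matrix_bvec2P => k l kN lN; rewrite -[LHS]mulmxA -[RHS]mulmxA.
rewrite flip_bvec2 // -scalemxAr !mulmxDl !tensmx_mul !mul1mx V_w'_bvec // V_w_bvec //.
rewrite !V_f_bvec // !tens_scale -[bvec k in LHS]scale1r -[bvec l in RHS]scale1r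
  !tens_scale.
rewrite !mul1r mulmxDr -!scalemxAr scalerDr !scalerA [LHS]addrC.
congr (_ + _).
  have [->|fk] := eqVneq (fcoef i k) 0; first by rewrite !(mulr0, mul0r) !scale0r.
  have ek := fcoef_ecoef fk.
  have kN' : (k.+1 < N)%N.
    by rewrite ltn_neqAle kN andbT; apply: contraNneq ek => ->; rewrite ecoefN.
  rewrite flip_bvec2 // scalerA; congr (_ *: _).
  by rewrite -[k in RHS]/(k.+1.-1) (flip_coef_pred' l ek) /w'coef; ring.
have [->|fl] := eqVneq (fcoef i l) 0; first by rewrite !(mulr0, mul0r) !scale0r.
have el := fcoef_ecoef fl.
have lN' : (l.+1 < N)%N.
  by rewrite ltn_neqAle lN andbT; apply: contraNneq el => ->; rewrite ecoefN.
rewrite flip_bvec2 // scalerA; congr (_ *: _).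
by rewrite -(flip_coef_pred rh0 sh0 k el) /=; ring.
Qed.

Lemma flip_unit : G \in unitmx.
Proof.
have tauK : tau_VV K n *m tau_VV K n = 1%:M.
  apply: matrix_bvec2P => k l kN lN; rewrite -mulmxA mul1mx !tau_bvec2 //.
pose F' := \sum_(a < N) \sum_(b < N) (f_weight rh sh (wt a) (wt b))^-1 *: (E a a *t E
  b b).
have FK : ftilde_VV rh sh n *m F' = 1%:M.
  apply: matrix_bvec2P => k l kN lN; rewrite -mulmxA mul1mx.
  rewrite (diag2_bvec2 (fun a b => (f_weight rh sh (wt a) (wt b))^-1)) //.
  rewrite -scalemxAr (diag2_bvec2 (fun a b => f_weight rh sh (wt a) (wt b))) //.
  by rewrite scalerA mulVf ?scale1r // invr_neq0 // wpair_neq0.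
by rewrite unitmx_mul (mulmx1_unit tauK).1 (mulmx1_unit FK).1.
Qed.

(** Beyond the scaled flip, [Rhat] produces only v_k (x) v_l with k > l and v_(i') (x) v_i with i <
    k; their first factors are never the highest weight vector. *)
Lemma highest_proj_Rhat : (0 < n)%N -> highest_proj *m Rhat rh sh n = highest_proj *m G.
Proof.
move=> n0; apply: matrix_bvec2P => k l kN lN;
  rewrite -[LHS]mulmxA -[RHS]mulmxA flip_bvec2 //.
rewrite Rhat_bvec2 // mulmxDr mulmxBr.
have P0 a b : (a < N)%N -> (b < N)%N -> a != 0%N -> highest_proj *m bvec2 a b = 0.
  move=> aN bN a0; rewrite tensmx_mul mul_E_bvec // eq_sym (negPf a0) scale0r.
  by rewrite tens0mx.
rewrite -!scalemxAr [highest_proj *m bvec2_sum _ _ _ _]mulmx_sumr big1.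
  rewrite scaler0 addr0; case: (ltnP l k) => lk; last by rewrite mulr0 scale0r subr0.
  by rewrite (P0 k l) ?scaler0 ?subr0 //; lia.
move=> i _; have ik := ltn_ord i.
have opN : (op i < N)%N by rewrite /Defs.op; lia.
have op0 : op i != 0%N by rewrite /Defs.op; lia.
by rewrite -scalemxAr P0 ?scaler0 //; lia.
Qed.
End Intertwiners.

(** * Theta on V (x) V and the two forms of the R-matrix *)

Section ThetaOperator.
Variables (K : fieldType) (rh sh : K) (n : nat).
Local Notation U := (Urs rh sh n).
Local Notation e := (U_e rh sh).
Local Notation f := (U_f rh sh).
Local Notation w := (U_w rh sh).
Local Notation w' := (U_w' rh sh).
Implicit Types (i j : 'I_n) (l : seq 'I_n) (lambda mu nu : 'rV[int]_n).
Variable Delta : {lrmorphism U -> tensor_alg U U}.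
Hypothesis Delta_cop : is_coproduct Delta.
Variable pair : U -> U -> K.
Hypothesis pairP : is_pairing Delta pair.
Hypotheses (rh0 : rh != 0) (sh0 : sh != 0) (n0 : (0 < n)%N).
Local Notation N := (2 * n)%N.
Variable rho : {lrmorphism U -> 'M[K]_N}.
Hypothesis rhoP : is_first_fundamental rho.
Variables (dim : 'rV[int]_n -> nat) (x y : forall mu, 'I_(dim mu) -> U).
Hypothesis xyP : forall mu, positive_weight mu -> is_dual_bases pair mu (@x mu) (@y mu).
Local Notation Delta_e := (@Delta_e K rh sh n).
Local Notation highest_proj := (@highest_proj K n).
Local Notation E := (@E K n).
Local Notation G := (ftilde_VV rh sh n *m tau_VV K n).
Local Notation Th := (Theta_VV rho x y).
Local Notation R := (Rhat_VV rho x y).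

(** For mu <> 0 the left leg of Theta_mu acts by strictly lower triangular matrices, so only Theta_0
    = 1 contributes when a1 <= b1, whatever a2 and b2 are. *)
Lemma Theta_VV_lower (a1 a2 b1 b2 : 'I_N) : (a1 <= b1)%N ->
  Th (mxtens_index (a1, a2)) (mxtens_index (b1, b2)) =
  (mxtens_index (a1, a2) == mxtens_index (b1, b2))%:R.
Proof.
move=> ab; pose r := undup (0 :: weights n).
rewrite (Theta_VV_sum rhoP xyP (r := r)) ?undup_uniq //; last first.
  by move=> mu; rewrite mem_undup.
rewrite (bigD1_seq 0) ?undup_uniq ?mem_undup ?mem_head //= mxE summxE big1.
  by rewrite addr0 /Theta_comp eqxx mxE.
move=> mu mu0; rewrite /Theta_comp (negPf mu0); case: asboolP => [mup|_];
  last by rewrite mxE.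
have [Uy _ _] := dual_bases_minus (xyP mup).
rewrite summxE big1 // => k _; rewrite /rho2 tensmxE.
by rewrite (rho_minus_lower rhoP (Uy k) mu0 ab) mul0r.
Qed.

Lemma Theta_VV_unit : Th \in unitmx.
Proof.
have Th_entry (a b : 'I_(N * N)) : (a <= b)%N -> Th a b = (a == b)%:R.
  case: (mxtens_indexP a) => a1 a2; case: (mxtens_indexP b) => b1 b2 /= ab.
  (* A pair (a1, a2) has index a1 N + a2 with a2 < N, so a <= b forces a1 <= b1. *)
  apply: Theta_VV_lower; rewrite -ltnS -(@ltn_pmul2r N); last by lia.
  apply: leq_ltn_trans (leq_trans (leq_addr _ _) ab) _.
  by rewrite (mulSn b1) addnC ltn_add2r.
rewrite unitmxE det_trig.
  by rewrite big1 ?unitr1 // => a _; rewrite Th_entry // eqxx.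
apply/is_trig_mxP => a b ab; rewrite Th_entry; last exact: ltnW.
by rewrite [a == b]ltn_eqF.
Qed.

Lemma highest_proj_Theta : highest_proj *m Th = highest_proj.
Proof.
rewrite -[RHS]mulmx1; apply/matrixP => a b; rewrite !mxE; apply: eq_bigr => c _.
case: (mxtens_indexP c) => c1 c2; case: (mxtens_indexP a) => a1 a2.
case: (mxtens_indexP b) => b1 b2.
have [c0|c0] := eqVneq (c1 : nat) 0%N.
  by congr (_ * _); rewrite Theta_VV_lower ?c0 // mxE.
by rewrite /highest_proj tensmxE [E _ _ _ _]mxE (negPf c0) andbF !mul0r.
Qed.

Lemma Rhat_VVE : R = Th *m G.
Proof. by rewrite /Rhat_VV mulmxA. Qed.

Lemma Delta_eE i : Delta_e i = rho2 rho (e i) 1 + rho2 rho (w i) (e i).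
Proof.
rewrite /Delta_e /rho2 (rmorph1 rho) (fundamental_e rhoP) (fundamental_w rhoP).
by [].
Qed.

Lemma Delta_e_Rhat_VV i : Delta_e i *m R = R *m Delta_e i.
Proof.
rewrite Rhat_VVE mulmxA Delta_eE.
rewrite (Theta_intertwines Delta_cop pairP rh0 sh0 rhoP xyP).
rewrite -[LHS]mulmxA -[RHS]mulmxA; congr (_ *m _); rewrite -Delta_eE flip_Delta_e //.
by rewrite /rho2 (rmorph1 rho) (fundamental_e rhoP) (fundamental_w' rhoP).
Qed.

Lemma highest_proj_Rhat_VV : highest_proj *m R = highest_proj *m G.
Proof. by rewrite Rhat_VVE mulmxA highest_proj_Theta. Qed.

Lemma Rhat_VV_unit : R \in unitmx.
Proof. by rewrite Rhat_VVE unitmx_mul Theta_VV_unit flip_unit. Qed.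

Lemma Rhat_VV_eq_Rhat : R = Rhat rh sh n.
Proof.
apply/eqP; rewrite -subr_eq0; apply/eqP.
apply: (@intertwiner_eq0 K rh sh n _ Delta_e) => [i|].
  by rewrite mulmxBr mulmxBl Delta_e_Rhat_VV Delta_e_Rhat.
by rewrite mulmxBr highest_proj_Rhat_VV highest_proj_Rhat // subrr.
Qed.

Definition coact (u : U) : 'M[K]_(N * N) := tensor_mx rho rho (Delta u).

Lemma coact_linear c u v : coact (c *: u + v) = c *: coact u + coact v.
Proof. by rewrite /coact linearP tensor_mx_linear. Qed.
Lemma coactM u v : coact (u * v) = coact u *m coact v.
Proof. by rewrite /coact rmorphM tensor_mxM. Qed.
Lemma coact1 : coact 1 = 1%:M.
Proof. by rewrite /coact rmorph1 tensor_mx1. Qed.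
Lemma coactB u v : coact (u - v) = coact u - coact v.
Proof. by rewrite addrC -scaleN1r coact_linear scaleN1r addrC. Qed.
Lemma coact0 : coact 0 = 0.
Proof. by rewrite -(subrr 0) coactB subrr. Qed.
Lemma coactZ c u : coact (c *: u) = c *: coact u.
Proof. by rewrite -[c *: u]addr0 coact_linear coact0 addr0. Qed.

Lemma coact_e i : coact (e i) = Delta_e i.
Proof.
rewrite /coact (coproduct_e Delta_cop) tensor_mxD !tensor_mx_tens.
by rewrite Delta_eE.
Qed.
Lemma coact_f i : coact (f i) = 1%:M *t V_f rh sh i + V_f rh sh i *t V_w' rh sh i.
Proof.
rewrite /coact (coproduct_f Delta_cop) tensor_mxD; congr (_ + _).
  rewrite [LHS]tensor_mx_tens; congr (_ *t _); first exact: rmorph1.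
  exact: fundamental_f.
rewrite [LHS]tensor_mx_tens; congr (_ *t _); first exact: fundamental_f.
exact: fundamental_w'.
Qed.
Lemma coact_w i : coact (w i) = V_w rh sh i *t V_w rh sh i.
Proof. by rewrite /coact (coproduct_w Delta_cop) tensor_mx_tens (fundamental_w rhoP).
  Qed.
Lemma coact_w' i : coact (w' i) = V_w' rh sh i *t V_w' rh sh i.
Proof. by rewrite /coact (coproduct_w' Delta_cop) tensor_mx_tens (fundamental_w'
  rhoP). Qed.

Definition centralizes u := coact u *m R = R *m coact u.

(** The commutator X of t with [Rhat_VV] satisfies Delta(e_i) X = X (c_i^-1 Delta(e_i)); this
    rescaling is why [intertwiner_eq0] allows an arbitrary right action. On the highest rows X
    vanishes, since D (x) D commutes with the projection and with the flip. *)
Lemma centralizes_diag (t : U) (D : 'M[K]_N) (d : nat -> K) (c : 'I_n -> K) :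
  coact t = D *t D -> (forall k, (k < N)%N -> D *m bvec K n k = d k *: bvec K n k) ->
  (forall i, c i != 0) -> (forall i, t * e i = c i *: (e i * t)) -> centralizes t.
Proof.
move=> tD Dd c0 te; apply/eqP; rewrite -subr_eq0; apply/eqP.
apply: (@intertwiner_eq0 K rh sh n _ (fun i => (c i)^-1 *: Delta_e i)) => [i|].
  have at_ : Delta_e i *m coact t = (c i)^-1 *: (coact t *m Delta_e i).
    by rewrite -coact_e -!coactM te coactZ scalerA mulVf ?scale1r.
  rewrite -scalemxAr mulmxBr mulmxBl scalerBr; congr (_ - _).
    by rewrite mulmxA at_ -scalemxAl -mulmxA Delta_e_Rhat_VV mulmxA.
  by rewrite mulmxA Delta_e_Rhat_VV -mulmxA at_ -scalemxAr mulmxA.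
have PT : highest_proj *m coact t = coact t *m highest_proj.
  by rewrite tD (highest_proj_diag Dd).
have GT : G *m coact t = coact t *m G by rewrite tD (flip_diag _ _ Dd).
rewrite mulmxBr mulmxA PT -mulmxA highest_proj_Rhat_VV.
rewrite [highest_proj *m (R *m _)]mulmxA highest_proj_Rhat_VV -[_ *m G *m _]mulmxA.
by rewrite GT [highest_proj *m (_ *m G)]mulmxA PT -mulmxA subrr.
Qed.

Lemma centralizes_w i : centralizes (w i).
Proof.
apply: centralizes_diag (coact_w i) _ _ (U_we rh sh i).
  exact: V_w_bvec.
by move=> j; exact: wpair_neq0.
Qed.

Lemma centralizes_w' i : centralizes (w' i).
Proof.
apply: centralizes_diag (coact_w' i) _ _ (U_w'e rh sh i).
  exact: V_w'_bvec.
by move=> j; rewrite mulf_neq0 ?invr_neq0 ?expfz_neq0.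
Qed.

Lemma centralizes_inv t t' : t * t' = 1 -> t' * t = 1 -> centralizes t -> centralizes
  t'.
Proof.
rewrite /centralizes => tt' t't cent.
transitivity (coact t' *m (coact t *m R) *m coact t').
  by rewrite cent -mulmxA -[R *m _ *m _]mulmxA -coactM tt' coact1 mulmx1.
by rewrite !mulmxA -coactM t't coact1 mul1mx.
Qed.

(** Jacobi identity: [a, [b, r]] = [[a, b], r] + [b, [a, r]], where both terms on the right
    vanish. *)
Lemma commutator_commutes m (a b t r : 'M[K]_m) c :
  a *m r = r *m a -> t *m r = r *m t -> a *m b = b *m a + c *: t ->
  a *m (b *m r - r *m b) = (b *m r - r *m b) *m a.
Proof.
move=> ar tr ab; rewrite mulmxBr mulmxBl !mulmxA ab ar -[r *m a *m b]mulmxA ab.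
rewrite mulmxDl mulmxDr -scalemxAl -scalemxAr tr opprD addrACA subrr addr0.
by rewrite -[b *m a *m r]mulmxA ar !mulmxA.
Qed.

(* The commutator of e_i and f_j lies in the torus, whose action already
   commutes with R, so [coact (f j), R] commutes with every coact (e i). *)
Lemma centralizes_f j : centralizes (f j).
Proof.
apply/eqP; rewrite -subr_eq0; apply/eqP.
apply: (@intertwiner_eq0 K rh sh n _ Delta_e) => [i|].
  have Ce := Delta_e_Rhat_VV i; rewrite -coact_e in Ce *.
  have CW : (coact (w i) - coact (w' i)) *m R = R *m (coact (w i) - coact (w' i)).
    have := centralizes_w i; have := centralizes_w' i; rewrite /centralizes.
    by move: (coact _) (coact _) R => a b r br ar; rewrite mulmxBl mulmxBr ar br.
  have ef := congr1 coact (U_ef rh sh i j).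
  rewrite coactB coactZ coactB !coactM in ef.
  move/eqP: ef; rewrite subr_eq addrC => /eqP.
  exact: commutator_commutes.
(* The highest weight vector is not reached by any f_j, so on its rows only 1 (x) f_j survives, both
   before and after the flip. *)
have Pf : highest_proj *m coact (f j) = (1%:M *t V_f rh sh j) *m highest_proj.
  rewrite coact_f mulmxDr !tensmx_mul highest_proj_V_f tens0mx addr0.
  by rewrite !mulmx1 !mul1mx.
have PGf : highest_proj *m (G *m coact (f j)) = (1%:M *t V_f rh sh j) *m
  (highest_proj *m G).
  rewrite coact_f flip_Delta_f //; move: G => Z; rewrite !mulmxA; congr (_ *m _).
  rewrite mulmxDr !tensmx_mul highest_proj_V_f tens0mx addr0.
  by rewrite !mulmx1 !mul1mx.
rewrite mulmxBr mulmxA Pf -mulmxA highest_proj_Rhat_VV.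
rewrite [highest_proj *m (R *m _)]mulmxA highest_proj_Rhat_VV -[_ *m G *m _]mulmxA.
by rewrite PGf subrr.
Qed.

Lemma coact_centralizes u : centralizes u.
Proof.
elim/presented_gen_ind: u => [|g|c u v Cu Cv|u v Cu Cv].
- by rewrite /centralizes coact1 mul1mx mulmx1.
- case: g => i.
  + by rewrite /centralizes -[presented_pi _ _]/(e i) coact_e Delta_e_Rhat_VV.
  + exact: centralizes_f.
  + exact: centralizes_w.
  + apply: centralizes_inv (U_wwV _ _ i) (U_wVw _ _ i) (centralizes_w i).
  + exact: centralizes_w'.
  + apply: centralizes_inv (U_w'w'V _ _ i) (U_w'Vw' _ _ i) (centralizes_w' i).
- by rewrite /centralizes coact_linear mulmxDl mulmxDr -scalemxAl -scalemxAr Cu Cv.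
- by rewrite /centralizes coactM -mulmxA Cv mulmxA Cu mulmxA.
Qed.

Lemma Rhat_VV_isomorphism : is_V2_isomorphism Delta rho R.
Proof.
split=> [|u ts Du]; first exact: Rhat_VV_unit.
have <- : coact u = V2_action rho ts by rewrite /coact Du tensor_mx_sum.
exact/esym/coact_centralizes.
Qed.
End ThetaOperator.

Theorem theorem4p5
  (R : realType) (K : closedFieldType)
  (iota : {rmorphism {fraction {poly {poly R[i]}}} -> K})
  (rh sh : K) (n : nat)
  (Delta : {lrmorphism Urs rh sh n -> tensor_alg (Urs rh sh n) (Urs rh sh n)})
  (pair : Urs rh sh n -> Urs rh sh n -> K)
  (dim : 'rV[int]_n -> nat)
  (x y : forall mu : 'rV[int]_n, 'I_(dim mu) -> Urs rh sh n)
  (rho : {lrmorphism Urs rh sh n -> 'M[K]_(2 * n)}) :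
  rh ^+ 2 = iota (tofrac ('X%:P)) ->
  sh ^+ 2 = iota (tofrac 'X) ->
  (0 < n)%N ->
  is_coproduct Delta ->
  is_pairing Delta pair ->
  (forall mu, positive_weight mu -> is_dual_bases pair mu (x mu) (y mu)) ->
  is_first_fundamental rho ->
  is_V2_isomorphism Delta rho (Rhat_VV rho x y) /\
  Rhat_VV rho x y = Rhat rh sh n.
Proof.
move=> rhE shE n0 cop pairP xyP rhoP.
have rh0 : rh != 0.
  have : rh ^+ 2 != 0 by rewrite rhE fmorph_eq0 tofrac_eq0 polyC_eq0 polyX_eq0.
  by rewrite expf_eq0.
have sh0 : sh != 0.
  have : sh ^+ 2 != 0 by rewrite shE fmorph_eq0 tofrac_eq0 polyX_eq0.
  by rewrite expf_eq0.
split; first exact: (Rhat_VV_isomorphism cop pairP rh0 sh0 n0 rhoP xyP).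
exact: (Rhat_VV_eq_Rhat cop pairP rh0 sh0 n0 rhoP xyP).
Qed.
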